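(* Let $n\ge 2$ and $k\ge 0$ be integers. For the Kneser graph $\mathrm{KG}(n,k)$, $$\gamma_t(\mathrm{KG}(n,k))\geq\frac{\binom{2n+k}{n}}{\binom{n+k}{n}}.$$ Let $\alpha_{n,k}=\frac{1}{2}\cdot\frac{\binom{2n+k}{n}}{\binom{n+k}{n}}$. If $\alpha_{n,k}$ is an integer, then the independence complex $\operatorname{Ind}(\mathrm{KG}(n,k))$ is $(\alpha_{n,k}-2)$-connected; otherwise it is $(\lfloor\alpha_{n,k}\rfloor-1)$-connected.
   Context: The Kneser graph $\mathrm{KG}(n,k)$ has as vertices the $n$-element subsets of $[2n+k]$, two vertices adjacent iff they are disjoint. For a graph $G$, $\operatorname{Ind}(G)$ is the simplicial complex whose simplices are the nonempty independent vertex sets of $G$. For a graph $G$ with no isolated vertices, a total dominating set is a set $D$ of vertices such that every vertex of $G$ is adjacent to some vertex of $D$, and the total domination number $\gamma_t(G)$ is the minimum size of a total dominating set. A space is $j$-connected if it is nonempty and its homotopy groups $\pi_i$ vanish for $0\le i\le j$. *)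

(* Defs.v *)
From HB Require Import structures.
From mathcomp Require Import all_boot all_order all_algebra.

Set Implicit Arguments.
Unset Strict Implicit.
Unset Printing Implicit Defensive.

Import Order.TTheory GRing.Theory Num.Theory.

Local Open Scope ring_scope.

(** Graphs are given by their adjacency relation on a finite vertex type. *)

Definition independent (V : finType) (e : rel V) (S : {set V}) : bool :=
  [forall u in S, forall v in S, ~~ e u v].

Definition independence_complex (V : finType) (e : rel V) : {set {set V}} :=
  [set S : {set V} | (S != set0) && independent e S].

Definition total_dominating (V : finType) (e : rel V) (D : {set V}) : bool :=
  [forall v, exists u in D, e v u].

(* A junk value if [e] has an isolated vertex: [arg min] then returns its
   default, the full vertex set, which otherwise is total dominating. *)
Definition total_domination_number (V : finType) (e : rel V) : nat :=
  #|[arg min_(D < [set: V] | total_dominating e D) #|D|]|.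

Lemma total_domination_numberP (V : finType) (e : rel V) :
  (forall v, exists u, e v u) ->
  (exists2 D : {set V}, total_dominating e D &
     #|D| = total_domination_number e) /\
  (forall D : {set V}, total_dominating e D ->
     (total_domination_number e <= #|D|)%N).
Proof.
move=> noiso; rewrite /total_domination_number; case: arg_minnP.
  apply/forallP => v; have [u evu] := noiso v.
  by apply/existsP; exists u; rewrite inE.
by move=> D tD minD; split => //; exists D.
Qed.

Definition kneser_vertex (n k : nat) : finType :=
  {S : {set 'I_(2 * n + k)%N} | #|S| == n}.

Definition kneser (n k : nat) : rel (kneser_vertex n k) :=
  fun S T => [disjoint val S & val T].

Lemma kneser_sym (n k : nat) : symmetric (@kneser n k).
Proof. by move=> S T; rewrite /kneser disjoint_sym. Qed.

Lemma kneser_irr (n k : nat) : (0 < n)%N -> irreflexive (@kneser n k).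
Proof.
move=> n0 S; apply/negbTE/negP; rewrite /kneser -setI_eq0 setIid.
by move=> /eqP S0; have := valP S; rewrite S0 cards0 => /eqP E; rewrite -E in n0.
Qed.

Lemma kneser_no_isolated (n k : nat) (S : kneser_vertex n k) :
  exists T, kneser S T.
Proof.
have /eqP cS := valP S.
have : (n <= #|~: val S|)%N.
  rewrite cardsCs setCK card_ord cS mul2n -addnn -addnA addKn.
  exact: leq_addr.
case/card_geqP => s [us ss sub].
have cT : #|[set x in s]| == n.
  by rewrite cardsE (card_uniqP us) ss.
exists (Sub [set x in s] cT); rewrite /kneser SubK disjoint_sym disjoint_subset.
by apply/fintype.subsetP => x /=; rewrite inE => /sub; rewrite !inE.
Qed.

Definition kneser_ratio (n k : nat) : rat :=
  'C((2 * n + k)%N, n)%:R / 'C((n + k)%N, n)%:R.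

Definition kneser_alpha (n k : nat) : rat := 1 / 2 * kneser_ratio n k.

From mathcomp Require Import all_classical all_reals topology normedtype.

Import numFieldNormedType.Exports.

Local Open Scope classical_set_scope.

(** Homotopy groups, via maps of the pairs ([0,1]^m, boundary) -> (X, x).
    Maps are total functions on R^m: only their values on the cube matter. *)

Definition cube (R : realType) (m : nat) : set {ptws 'I_m -> R} :=
  [set t | forall i, 0 <= t i <= 1].
Arguments cube : clear implicits.

(* This is empty for m = 0, where the cube is a single point. *)
Definition cube_boundary (R : realType) (m : nat) : set {ptws 'I_m -> R} :=
  [set t | cube R m t /\ exists i, t i = 0 \/ t i = 1].
Arguments cube_boundary : clear implicits.

Definition spheroid (R : realType) (m : nat) (X : topologicalType) (x : X)
    (f : {ptws 'I_m -> R} -> X) : Prop :=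
  {within cube R m, continuous f} /\
  forall t, cube_boundary R m t -> f t = x.

(* Homotopy relative to the boundary; [H (s, t)] is at time [s]. *)
Definition homotopic (R : realType) (m : nat) (X : topologicalType) (x : X)
    (f g : {ptws 'I_m -> R} -> X) : Prop :=
  exists H : R * {ptws 'I_m -> R} -> X,
    [/\ {within `[0, 1] `*` cube R m, continuous H},
        forall t, cube R m t -> H (0, t) = f t,
        forall t, cube R m t -> H (1, t) = g t &
        forall s t, 0 <= s <= 1 -> cube_boundary R m t -> H (s, t) = x].

Definition homotopy_class (R : realType) (m : nat) (X : topologicalType) (x : X)
    (f : {ptws 'I_m -> R} -> X) : set ({ptws 'I_m -> R} -> X) :=
  [set g | spheroid x g /\ homotopic x f g].

(* The underlying pointed set of pi_m(X, x), with base point the class of the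
   constant map; the group law plays no role in whether it vanishes.  For m = 0
   this is the set of path components of X. *)
Definition homotopy_group (R : realType) (m : nat) (X : topologicalType)
    (x : X) : set (set ({ptws 'I_m -> R} -> X)) :=
  [set homotopy_class x f | f in spheroid x].
Arguments homotopy_group R m {X} x.

Definition homotopy_group_vanishes (R : realType) (m : nat)
    (X : topologicalType) (x : X) : Prop :=
  homotopy_group R m x = [set homotopy_class x (cst x)].
Arguments homotopy_group_vanishes R m {X} x.

(* For [j < 0] this only says that [X] is nonempty. *)
Definition j_connected (R : realType) (j : int) (X : topologicalType) : Prop :=
  [set: X] !=set0 /\
  forall (i : nat) (x : X), i%:Z <= j -> homotopy_group_vanishes R i x.

(** Finite simplicial complexes are given by their sets of nonempty simplices.
    The geometric realization is coded by barycentric coordinates. *)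

Definition realization (R : realType) (V : finType) (K : {set {set V}}) :
    topologicalType :=
  set_type [set p : {ptws V -> R} |
    [/\ forall v, 0 <= p v,
        \sum_v p v = 1 &
        finset (fun v => p v != 0) \in K]].
Arguments realization R {V} K.

(* Main.v *)
Require Import Defs.
From mathcomp Require Import all_boot all_order all_algebra.
From mathcomp Require Import all_classical all_reals topology normedtype.
From mathcomp Require Import interval_inference ring lra zify.

(* Counting the vertices dominated by each element of a total dominating set
   bounds [gamma_t] from below, since Kneser graphs are regular.  For any graph
   with [2 d < gamma_t], every map of a sphere of dimension less than [d] to the
   independence complex extends to the ball.  If no [2 d] vertices dominate the
   graph, write the complex as the union of the closed vertex stars, added one
   at a time: the first star is a cone, and each new star meets the union of the
   previous ones in a union of links of the same kind, for which the domination
   hypothesis holds with [d - 1].  One concludes by induction with the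
   Mayer-Vietoris type fact that [K1 u K2] fills spheres up to dimension [d]
   when [K1] and [K2] do and [K1 n K2] does up to [d - 1].  That fact is proved
   by hand: after pushing a map of the boundary of a cube off the small
   barycentric coordinates, each cell of a fine grid lands in one simplex, hence
   in [K1] or in [K2]; the cells outside [K2] are then homotoped into [K1 n K2]
   by induction on skeleta. *)

Set Implicit Arguments.
Unset Strict Implicit.
Unset Printing Implicit Defensive.

Import Order.TTheory GRing.Theory Num.Theory numFieldNormedType.Exports.

Local Open Scope classical_set_scope.
Local Open Scope ring_scope.

(** * Continuity on subsets *)

(* Unlike the bare [{within A, continuous f}], this fixes the topology on the
   codomain once and for all. *)
Definition cont_on (T U : topologicalType) (A : set T) (f : T -> U) : Prop :=
  {within A, continuous f}.

Lemma cont_onP (T U : topologicalType) (A : set T) (f : T -> U) :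
  cont_on A f <-> (forall t, A t -> f @ within A (nbhs t) --> f t).
Proof. exact: subspace_continuousP. Qed.

Section WithinContinuity.
Context {R : realType}.
Implicit Types T : topologicalType.

Lemma cont_on_cst T (A : set T) (U : topologicalType) (a : U) :
  cont_on A (fun=> a).
Proof. by move=> t; exact: cvg_cst. Qed.

Lemma cont_onD T (A : set T) (f g : T -> R) :
  cont_on A f -> cont_on A g ->
  cont_on A (fun t => f t + g t).
Proof. by move=> cf cg t; apply: cvgD; [exact: cf|exact: cg]. Qed.

Lemma cont_onN T (A : set T) (f : T -> R) :
  cont_on A f -> cont_on A (fun t => - f t).
Proof. by move=> cf t; apply: cvgN; exact: cf. Qed.

Lemma cont_onM T (A : set T) (f g : T -> R) :
  cont_on A f -> cont_on A g ->
  cont_on A (fun t => f t * g t).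
Proof. by move=> cf cg t; apply: cvgM; [exact: cf|exact: cg]. Qed.

Lemma cont_onV T (A : set T) (f : T -> R) :
  cont_on A f -> (forall t, A t -> f t != 0) ->
  cont_on A (fun t => (f t)^-1).
Proof.
move=> /cont_onP cf f0; apply/cont_onP => t At.
by apply: cvgV; [exact: f0|exact: cf].
Qed.

Lemma cont_on_max T (A : set T) (f g : T -> R) :
  cont_on A f -> cont_on A g ->
  cont_on A (fun t => Num.max (f t) (g t)).
Proof.
move=> cf cg t.
by apply: (@continuous_max R (subspace A) f g t); [exact: cf|exact: cg].
Qed.

Lemma cont_on_norm T (A : set T) (f : T -> R) :
  cont_on A f -> cont_on A (fun t => `|f t|).
Proof. by move=> cf t; apply: cvg_norm; exact: cf. Qed.

Lemma cont_on_sum T (A : set T) (J : Type) (r : seq J) (f : J -> T -> R) :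
  (forall j, cont_on A (f j)) ->
  cont_on A (fun t => \sum_(j <- r) f j t).
Proof.
move=> cf; elim: r => [|j r IHr].
  rewrite (_ : (fun _ => _) = fun=> 0); first exact: cont_on_cst.
  by apply/funext => t; rewrite big_nil.
rewrite (_ : (fun _ => _) = fun t => f j t + \sum_(i <- r) f i t).
  exact: cont_onD.
by apply/funext => t; rewrite big_cons.
Qed.

Lemma cont_on_bigmax T (A : set T) (J : Type) (r : seq J) (f : J -> T -> R) :
  (forall j, cont_on A (f j)) ->
  cont_on A (fun t => \big[Num.max/0]_(j <- r) f j t).
Proof.
move=> cf; elim: r => [|j r IHr].
  rewrite (_ : (fun _ => _) = fun=> 0); first exact: cont_on_cst.
  by apply/funext => t; rewrite big_nil.
rewrite (_ : (fun _ => _) = fun t =>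
  Num.max (f j t) (\big[Num.max/0]_(i <- r) f i t)).
  exact: cont_on_max.
by apply/funext => t; rewrite big_cons.
Qed.

Lemma cont_on_eq T (U : topologicalType) (A : set T) (f g : T -> U) :
  (forall t, A t -> f t = g t) ->
  cont_on A f -> cont_on A g.
Proof.
by move=> fg; apply: subspace_eq_continuous => t; rewrite inE; exact: fg.
Qed.

(** The pointwise topology is the supremum of the topologies pulled back along the coordinates, so
    convergence is tested on each coordinate. *)
Lemma cvg_ptws (I : Type) (F : set_system {ptws I -> R}) (t : {ptws I -> R}) :
  Filter F -> (forall i, (fun s => s i) @ F --> t i) -> F --> t.
Proof.
move=> FF Ft; apply/cvg_sup => i A [B [[C oC <-] Ct CA]].
apply: filterS CA _; apply: Ft; exact: open_nbhs_nbhs.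
Qed.

Lemma cont_on_coord (I : eqType) (A : set {ptws I -> R}) (i : I) :
  cont_on A (fun t : {ptws I -> R} => t i).
Proof. by apply: continuous_subspaceT; exact: proj_continuous. Qed.

Lemma cont_on_comp T T' (U : topologicalType) (A : set T) (B : set T')
    (f : T -> T') (g : T' -> U) :
  (forall t, A t -> B (f t)) -> cont_on A f ->
  cont_on B g -> cont_on A (g \o f).
Proof.
move=> AB /cont_onP cf /cont_onP cg.
apply/cont_onP => t At.
apply: cvg_trans (cg _ (AB _ At)).
move=> S /= /(cf t At) /= tS.
rewrite /nbhs /= /within /= in tS *.
by apply: filterS tS => s + As; apply => //; exact: AB.
Qed.

Lemma cont_on_ptws T (I : Type) (A : set T) (f : T -> {ptws I -> R}) :
  (forall i, cont_on A (fun t => f t i)) ->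
  cont_on A f.
Proof.
move=> cf; apply/cont_onP => t At.
apply: cvg_ptws => i.
by have /cont_onP := cf i; exact.
Qed.

End WithinContinuity.

(** * Extension over finite cell complexes *)

Section Maps.
Context {R : realType} {V : finType}.
Implicit Types (T : topologicalType) (X : set (V -> R)).

(** Continuity is asked of each coordinate, so the target is a bare set of functions and [f] may be
    arbitrary outside [A]. *)
Definition map_on T (A : set T) X (f : T -> V -> R) : Prop :=
  (forall v, cont_on A (fun t => f t v)) /\
  (forall t, A t -> X (f t)).

Lemma map_on_eq T (A : set T) X (f g : T -> V -> R) :
  (forall t, A t -> f t = g t) -> map_on A X f -> map_on A X g.
Proof.
move=> fg [cf Xf]; split=> [v|t At]; last by rewrite -fg //; exact: Xf.
by apply: cont_on_eq (cf v) => t At; rewrite fg.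
Qed.

Lemma map_onW T (A B : set T) X X' (f : T -> V -> R) :
  A `<=` B -> (forall t, A t -> X (f t) -> X' (f t)) ->
  map_on B X f -> map_on A X' f.
Proof.
move=> AB XX' [cf Xf]; split=> [v|t At]; last by apply: XX' => //; exact/Xf/AB.
exact: (continuous_subspaceW AB (cf v)).
Qed.

Lemma map_on_comp T T' (A : set T) (B : set T') X (u : T -> T')
    (f : T' -> V -> R) :
  (forall t, A t -> B (u t)) -> cont_on A u ->
  map_on B X f -> map_on A X (f \o u).
Proof.
move=> AB cu [cf Xf]; split=> [v|t At]; last exact/Xf/AB.
exact: (cont_on_comp AB cu (cf v)).
Qed.

Lemma map_onU T (A B : set T) X (f : T -> V -> R) :
  closed A -> closed B -> map_on A X f -> map_on B X f -> map_on (A `|` B) X f.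
Proof.
move=> cA cB [cfA XA] [cfB XB]; split=> [v|t [At|Bt]]; last 2 first.
- exact: XA.
- exact: XB.
by apply: withinU_continuous => //; [exact: cfA|exact: cfB].
Qed.

Lemma map_on_cst T (A : set T) X (p : V -> R) : X p -> map_on A X (fun=> p).
Proof. by move=> Xp; split=> // v; exact: cont_on_cst. Qed.

Lemma exists2_bigsetU T (C : finType) (P : pred C) (F : C -> set T) :
  [set t | exists2 c, P c & F c t] = \big[setU/set0]_(c | P c) F c.
Proof.
apply/seteqP; split=> [t [c Pc Fct]|t].
  by rewrite (bigD1 c) //=; left.
by elim/big_ind: _ => [[]|A B IA IB [/IA|/IB]|c Pc Fct] //; exists c.
Qed.

Lemma closed_exists2 T (C : finType) (P : pred C) (F : C -> set T) :
  (forall c, closed (F c)) -> closed [set t | exists2 c, P c & F c t].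
Proof.
move=> clF; rewrite exists2_bigsetU; elim/big_ind: _ => // [|A B].
- exact: closed0.
- exact: closedU.
Qed.

Lemma map_on_exists2 T (C : finType) (P : pred C) (F : C -> set T) X
    (f : T -> V -> R) :
  (forall c, closed (F c)) -> (forall c, P c -> map_on (F c) X f) ->
  map_on [set t | exists2 c, P c & F c t] X f.
Proof.
move=> clF mf; rewrite exists2_bigsetU.
suff [] : closed (\big[setU/set0]_(c | P c) F c) /\
    map_on (\big[setU/set0]_(c | P c) F c) X f by [].
elim/big_ind: _ => [|A B [? ?] [? ?]|c Pc].
- by split; [exact: closed0|split=> // v; exact: continuous_subspace0].
- by split; [exact: closedU|exact: map_onU].
- by split; [exact: clF|exact: mf].
Qed.

(** A combinatorial boundary: the union of the cells of smaller dimension contained in [F c]. It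
    need not be the topological one. *)
Definition cell_boundary T (C : finType) (F : C -> set T) (dim : C -> nat)
    (c : C) : set T :=
  [set t | exists2 c', (dim c' < dim c)%N /\ F c' `<=` F c & F c' t].

(** Induction on skeleta: a map on the cells of dimension less than [q] is extended over each cell
    of dimension [q] separately. By the second hypothesis two such cells meet only inside lower
    cells, so the extensions glue. [P] is a condition to be kept along the way, and it depends only
    on the values on the cell. *)
Lemma skeleton_extension T (C : finType) (F : C -> set T) (dim : C -> nat)
    (P : C -> (T -> V -> R) -> Prop) :
  (forall c, closed (F c)) ->
  (forall c c' t, c' != c -> (dim c' <= dim c)%N -> F c t -> F c' t ->
     cell_boundary F dim c t) ->
  (forall c h h', (forall t, F c t -> h t = h' t) -> P c h -> P c h') ->
  (forall c h, map_on (cell_boundary F dim c) setT h ->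
     (forall c', (dim c' < dim c)%N -> F c' `<=` F c -> P c' h) ->
     exists h', [/\ map_on (F c) setT h',
       forall t, cell_boundary F dim c t -> h' t = h t & P c h']) ->
  exists2 h, map_on [set t | exists c, F c t] setT h & forall c, P c h.
Proof.
move=> clF sepF extP extF.
suff skel q : exists2 h,
    map_on [set t | exists2 c, (dim c < q)%N & F c t] setT h &
    forall c, (dim c < q)%N -> P c h.
  have dimlt c : (dim c < (\max_c dim c).+1)%N by rewrite ltnS leq_bigmax.
  have [h mh Ph] := skel (\max_c dim c).+1.
  exists h => [|c]; last exact: Ph.
  by apply: map_onW mh => // t [c Fct]; exists c.
elim: q => [|q [h mh Ph]].
  by exists (fun=> fun=> 0) => //; apply: (@map_on_cst _ _ setT).
have /choice[h' Hh'] c : exists h', dim c = q -> [/\ map_on (F c) setT h',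
    forall t, cell_boundary F dim c t -> h' t = h t & P c h'].
  have [dc|] := eqVneq (dim c) q; last by move=> /eqP; exists h.
  have [||h' Hh'] := extF c h; last by exists h'.
  - by apply: map_onW mh => // t [c' [+ _]]; rewrite dc; exists c'.
  - by move=> c'; rewrite dc => ? _; exact: Ph.
(* The new map is [h] on the lower skeleton, and elsewhere the extension chosen for some cell of
   dimension [q] through the point; [gh'] shows that the choice of the cell does not matter. *)
pose low t := `[< exists2 c, (dim c < q)%N & F c t >].
pose g t := if low t then h t else
  if [pick c | (dim c == q) && `[< F c t >]] is Some c then h' c t else h t.
have gh c t : (dim c < q)%N -> F c t -> g t = h t.
  by move=> dc Fct; rewrite /g /low; case: asboolP => // -[]; exists c.
have gh' c t : dim c = q -> F c t -> g t = h' c t.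
  move=> dc Fct; have [_ hh' _] := Hh' c dc.
  rewrite /g /low; case: asboolP => [[c' dc' Fc't]|nlow].
    rewrite hh' //; apply: (sepF c c') => //; last by rewrite dc ltnW.
    by apply: contraTneq dc' => ->; rewrite dc ltnn.
  case: pickP => [c1 /andP[/eqP dc1 /asboolP Fc1t]|/(_ c)]; last first.
    by rewrite dc eqxx; case: asboolP.
  have [->//|c1c] := eqVneq c1 c.
  (* Two distinct cells of dimension [q] through [t] would put [t] in the lower skeleton. *)
  have [|c2 [dc2 _] Fc2t] := sepF c c1 t c1c _ Fct Fc1t;
    first by rewrite dc1 dc.
  by case: nlow; exists c2 => //; rewrite -dc.
exists g => [|c]; last first.
  rewrite ltnS leq_eqVlt => /orP[/eqP dc|dc].
    by have [_ _] := Hh' c dc; apply: extP => t Fct; rewrite (gh' c).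
  by apply: extP (Ph c dc) => t Fct; rewrite (gh c).
apply: map_on_exists2 => // c.
rewrite ltnS leq_eqVlt => /orP[/eqP dc|dc].
  by have [mh' _ _] := Hh' c dc; apply: map_on_eq mh' => t Fct; rewrite (gh' c).
have mhc : map_on (F c) setT h by apply: map_onW mh => // t Fct; exists c.
by apply: map_on_eq mhc => t Fct; rewrite (gh c).
Qed.

End Maps.

(** * Boxes, their boundaries and the sup norm *)

Section Boxes.
Context {R : realType}.
Implicit Types I : finType.

Definition box I (lo hi : I -> R) : set {ptws I -> R} :=
  [set t | forall i, lo i <= t i <= hi i].

(** Only coordinates with [lo i < hi i] count: this is the boundary of the box relative to its
    affine span, empty when the box is a point. *)
Definition box_boundary I (lo hi : I -> R) : set {ptws I -> R} :=
  [set t | box lo hi t /\ exists i, lo i < hi i /\ (t i = lo i \/ t i = hi i)].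

Lemma closed_coord_le I (i : I) (a : R) :
  closed [set t : {ptws I -> R} | t i <= a].
Proof.
apply: (@closed_comp _ _ (fun t : {ptws I -> R} => t i) [set x | x <= a]).
  by move=> t _; exact: proj_continuous.
exact: closed_le.
Qed.

Lemma closed_coord_ge I (i : I) (a : R) :
  closed [set t : {ptws I -> R} | a <= t i].
Proof.
apply: (@closed_comp _ _ (fun t : {ptws I -> R} => t i) [set x | a <= x]).
  by move=> t _; exact: proj_continuous.
exact: closed_ge.
Qed.

Lemma closed_coord_eq I (i : I) (a : R) :
  closed [set t : {ptws I -> R} | t i = a].
Proof.
have -> : [set t : {ptws I -> R} | t i = a] =
    [set t | t i <= a] `&` [set t | a <= t i].
  apply/seteqP; split=> t /=; first by move->.
  by case=> ta at_; apply/eqP; rewrite eq_le ta at_.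
by apply: closedI; [exact: closed_coord_le|exact: closed_coord_ge].
Qed.

Lemma closed_box I (lo hi : I -> R) : closed (box lo hi).
Proof.
have -> : box lo hi =
    \bigcap_i ([set t | lo i <= t i] `&` [set t | t i <= hi i]).
  apply/seteqP; split=> [t tb i _|t tb i]; first by have /andP := tb i.
  by apply/andP; exact: tb.
apply: closed_bigI => i _.
by apply: closedI; [exact: closed_coord_ge|exact: closed_coord_le].
Qed.

Lemma compact_box I (lo hi : I -> R) : compact (box lo hi).
Proof.
have -> : box lo hi =
    [set t : {ptws I -> R} | forall i, [set` `[lo i, hi i]] (t i)].
  by apply/seteqP; split=> t tb i; have := tb i; rewrite /= in_itv.
apply: (@tychonoff I (fun=> R : topologicalType)
  (fun i => [set` `[lo i, hi i]])).
by move=> i; exact: segment_compact.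
Qed.

Lemma closed_box_boundary I (lo hi : I -> R) : closed (box_boundary lo hi).
Proof.
have -> : box_boundary lo hi = box lo hi `&` [set t | exists2 i, lo i < hi i &
    ([set t | t i = lo i] `|` [set t | t i = hi i]) t].
  by apply/seteqP; split=> t [tb [i]]; [case=> li ti|move=> li ti];
    split=> //; exists i.
apply: closedI; first exact: closed_box.
apply: closed_exists2 => i.
by apply: closedU; exact: closed_coord_eq.
Qed.

Definition sup_norm I (t : I -> R) : R := \big[Num.max/0]_i `|t i|.

Lemma le_sup_norm I (t : I -> R) i : `|t i| <= sup_norm t.
Proof. exact: le_bigmax. Qed.

Lemma sup_norm_attained I (t : I -> R) : 0 < sup_norm t ->
  exists i, `|t i| = sup_norm t.
Proof.
rewrite /sup_norm; elim/big_rec: _ => [|i x _ IH]; first by rewrite ltxx.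
case: (leP x `|t i|) => [_ _|_ /IH//]; by exists i.
Qed.

Lemma sup_norm_le I (t : I -> R) a :
  0 <= a -> (forall i, `|t i| <= a) -> sup_norm t <= a.
Proof.
by move=> a0 ta; rewrite /sup_norm; elim/big_ind: _ => // x y;
  rewrite ge_max => -> ->.
Qed.

Lemma cont_on_sup_norm I (A : set {ptws I -> R}) :
  cont_on A (@sup_norm I).
Proof. by apply: cont_on_bigmax => i; apply: cont_on_norm;
  exact: cont_on_coord. Qed.

Lemma continuous_sup_norm I : continuous (@sup_norm I : {ptws I -> R} -> R).
Proof. by apply/continuous_subspace_setT; apply: cont_on_sup_norm. Qed.

End Boxes.

(** * Filling spheres in cubes *)

Local Notation scube R I := (@box R I (fun=> -1) (fun=> 1)).
Local Notation ssphere R I := (@box_boundary R I (fun=> -1) (fun=> 1)).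

Section Extension.
Context {R : realType} {V : finType}.
Implicit Types (T : topologicalType) (I : finType) (X : set (V -> R)).

Definition extendable I (lo hi : I -> R) X (f : {ptws I -> R} -> V -> R) :=
  exists2 g, map_on (box lo hi) X g &
    forall t, box_boundary lo hi t -> g t = f t.

(* This is (d - 1)-connectedness: [#|I| <= d] is the dimension of the cube. *)
Definition fills_spheres X (d : nat) : Prop :=
  forall I (f : {ptws I -> R} -> V -> R), (#|I| <= d)%N ->
  map_on (ssphere R I) X f -> extendable (fun _ : I => -1) (fun=> 1) X f.

(** The index [None] is the time coordinate, so that a cylinder over a subset of a cube is again
    made of boxes. *)
Definition at_time I (s : R) (t : I -> R) : {ptws option I -> R} :=
  fun o => if o is Some i then t i else s.

Definition spatial I (t : option I -> R) : {ptws I -> R} := fun i => t (Some i).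

Lemma cont_on_spatial I (A : set {ptws option I -> R}) :
  cont_on A (@spatial I).
Proof. by apply: cont_on_ptws => i; exact: cont_on_coord. Qed.

Lemma cont_on_at_time T (A : set T) I (s : T -> R) (u : T -> {ptws I -> R}) :
  cont_on A s -> cont_on A u ->
  cont_on A (fun t => at_time (s t) (u t)).
Proof.
move=> cs cu; apply: cont_on_ptws => -[i|] //=.
apply: (@cont_on_comp _ _ _ A setT u (fun t => t i)) => //.
exact: cont_on_coord.
Qed.

Lemma scubeE I (t : {ptws I -> R}) : scube R I t <-> sup_norm t <= 1.
Proof.
split=> [tb|t1 i]; last by rewrite -ler_norml (le_trans (le_sup_norm t i)).
by apply: sup_norm_le => // i; rewrite ler_norml; exact: tb.
Qed.

Lemma ssphereE I (t : {ptws I -> R}) : ssphere R I t <-> sup_norm t = 1.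
Proof.
split=> [[/scubeE t1 [i [_ ti]]]|t1].
  apply/eqP; rewrite eq_le t1 /= (le_trans _ (le_sup_norm t i)) //.
  by case: ti => ->; rewrite ?normrN normr1.
split; first by apply/scubeE; rewrite t1.
have [|i] := @sup_norm_attained R I t; first by rewrite t1.
rewrite t1 => /eqP; rewrite eqr_norml => /andP[/orP[]/eqP ti _]; exists i;
  split; [lra|by right|lra|by left].
Qed.

Lemma sup_normZ I a (t : I -> R) : 0 <= a ->
  sup_norm (fun i => a * t i) = a * sup_norm t.
Proof.
move=> a0; rewrite /sup_norm.
by elim/big_rec2: _ => [|i x y _ ->];
  rewrite ?mulr0 // maxr_pMr // normrM ger0_norm.
Qed.

Definition cylinder I : set {ptws option I -> R} :=
  [set t | ssphere R I (spatial t) /\ 0 <= t None <= 1].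

(* Insert the homotopy in the collar between the half-size cube and the cube. *)
Lemma homotopy_extendable I X (H : {ptws option I -> R} -> V -> R) :
  map_on (@cylinder I) X H ->
  extendable (fun _ : I => -1) (fun=> 1) X
    (fun t : {ptws I -> R} => H (at_time 1 t)) ->
  extendable (fun _ : I => -1) (fun=> 1) X
    (fun t : {ptws I -> R} => H (at_time 0 t)).
Proof.
move=> mH [G mG GH].
pose A := scube R I `&` [set t | 2^-1 <= sup_norm t].
pose B := scube R I `&` [set t | sup_norm t <= 2^-1].
(* Radius [r] in [1/2, 1] becomes time [2 * (1 - r)] while the point is projected radially to the
   sphere; [inner] stretches the half-size cube to the whole one. The two definitions agree at
   radius 1/2, which is time 1. *)
pose outer (t : {ptws I -> R}) : {ptws option I -> R} :=
  at_time (2 * (1 - sup_norm t)) (fun i => (sup_norm t)^-1 * t i).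
pose inner (t : {ptws I -> R}) : {ptws I -> R} := fun i => 2 * t i.
pose g t := if 2^-1 <= sup_norm t then H (outer t) else G (inner t).
have clA : closed A.
  apply: closedI; first exact: closed_box.
  apply: (@closed_comp {ptws I -> R} _
    (@sup_norm R I) [set x | 2^-1 <= x]) => [t _|].
    exact: continuous_sup_norm.
  exact: closed_ge.
have clB : closed B.
  apply: closedI; first exact: closed_box.
  apply: (@closed_comp {ptws I -> R} _
    (@sup_norm R I) [set x | x <= 2^-1]) => [t _|].
    exact: continuous_sup_norm.
  exact: closed_le.
have mA : map_on A X g.
  have mo : map_on A X (H \o outer).
    apply: map_on_comp mH => [t [/scubeE t1 /= t2]|].
      split; last by rewrite /=; lra.
      apply/ssphereE; rewrite /outer /spatial /= sup_normZ ?invr_ge0; last lra.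
      by rewrite mulVf //; lra.
    apply: cont_on_at_time.
      apply: cont_onM; first exact: cont_on_cst.
      apply: cont_onD; first exact: cont_on_cst.
      by apply: cont_onN; exact: cont_on_sup_norm.
    apply: cont_on_ptws => i; apply: cont_onM; last exact: cont_on_coord.
    apply: cont_onV => [|t [_ /=]]; first exact: cont_on_sup_norm.
    by move=> ?; apply/eqP; lra.
  by apply: map_on_eq mo => t [_ /= t2]; rewrite /g t2.
have mB : map_on B X g.
  have mi : map_on B X (G \o inner).
    apply: map_on_comp mG => [t [_ /= t2]|].
      by apply/scubeE; rewrite /inner sup_normZ //; lra.
    apply: cont_on_ptws => i; apply: cont_onM; first exact: cont_on_cst.
    exact: cont_on_coord.
  apply: map_on_eq mi => t [_ /= t2]; rewrite /g; case: leP => // t2'.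
  have te : sup_norm t = 2^-1 by apply/eqP; rewrite eq_le t2 t2'.
  rewrite GH.
    by rewrite /outer te invrK; congr (H (at_time _ _)); lra.
  by apply/ssphereE; rewrite /inner sup_normZ // te divff ?pnatr_eq0.
exists g => [|t /ssphereE t1].
  apply: map_onW (map_onU clA clB mA mB) => // t tb.
  by have [?|?] := leP 2^-1 (sup_norm t); [left|right; split=> //; exact: ltW].
rewrite /g t1 ifT; last lra.
rewrite /outer t1 invr1; congr (H (at_time _ _)); first lra.
by apply/funext => i; rewrite mul1r.
Qed.

(** The nondegenerate coordinates [J] are identified affinely with those of the standard cube of
    dimension [#|J|]; [u] puts back the constant value [lo] on the others. *)
Lemma fills_spheres_box X d I (lo hi : I -> R) (f : {ptws I -> R} -> V -> R) :
  fills_spheres X d -> (forall i, lo i <= hi i) ->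
  (#|[pred i | (lo i < hi i)%R]| <= d)%N ->
  map_on (box_boundary lo hi) X f -> extendable lo hi X f.
Proof.
move=> Xd lohi dim mf.
pose J := {i : I | lo i < hi i}.
pose mid i := (lo i + hi i) / 2; pose rad i := (hi i - lo i) / 2.
pose u (s : {ptws J -> R}) : {ptws I -> R} :=
  fun i => if insub i is Some j then mid i + s j * rad i else lo i.
pose w (t : {ptws I -> R}) : {ptws J -> R} :=
  fun j => (t (val j) - mid (val j)) / rad (val j).
have rad0 (j : J) : 0 < rad (val j) by have := valP j; rewrite /rad; lra.
have uj s (j : J) : u s (val j) = mid (val j) + s j * rad (val j).
  by rewrite /u valK.
have ubox s : scube R J s -> box lo hi (u s).
  move=> sb i; rewrite /u; case: insubP => [j _ ji|_].
    have := sb j; have := rad0 j; rewrite ji /rad /mid => r0 /andP[s1 s2].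
    by nra.
  by rewrite lexx lohi.
have wK t : box lo hi t -> u (w t) = t.
  move=> tb; apply/funext => i; rewrite /u; case: insubP => [j _ ji|].
    by rewrite /w -ji divfK ?gt_eqF //; lra.
  by have := tb i; rewrite -leNgt; lra.
have cu A : cont_on A u.
  apply: cont_on_ptws => i; rewrite /u; case: insubP => [j _ _|_].
    apply: cont_onD; first exact: cont_on_cst.
    by apply: cont_onM; [exact: cont_on_coord|exact: cont_on_cst].
  exact: cont_on_cst.
have cw A : cont_on A w.
  apply: cont_on_ptws => j; apply: cont_onM; last exact: cont_on_cst.
  by apply: cont_onD; [exact: cont_on_coord|exact: cont_on_cst].
have [||g mg gf] := Xd J (f \o u).
- by rewrite card_sig.
- apply: map_on_comp mf => // s [sb [j [_ sj]]]; split; first exact: ubox.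
  exists (val j); split; first exact: (valP j).
  by rewrite uj /mid /rad; case: sj => ->; [left|right]; field.
exists (g \o w).
  apply: map_on_comp mg => // t tb j.
  rewrite ler_pdivlMr // ler_pdivrMr //.
  by have := tb (val j); rewrite /mid /rad; lra.
move=> t [tb [i [li ti]]]; rewrite /= gf /= ?wK //.
split.
  move=> j; rewrite ler_pdivlMr // ler_pdivrMr //.
  by have := tb (val j); rewrite /mid /rad; lra.
exists (Sub i li : J); split; first lra.
rewrite /w /= /mid /rad; case: ti => ->; [left|right].
  by field; lra.
by field; lra.
Qed.

End Extension.

(** * Grids on the boundary of a cube *)

Section Grid.
Context {R : realType} (I : finType) (M : nat) (M0 : (0 < M)%N).

(* A cell is a product of intervals [a, a + e] with [e] in {0, 1}, in units of
   [2 / M] and with origin at the lower corner of the cube. *)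
Definition cell : finType := {ffun I -> 'I_M.+1 * bool}.
Implicit Types c : cell.

Definition cell_dim c : nat := #|[pred i | (c i).2]|.
Definition cell_lo c (i : I) : R := -1 + 2 * (c i).1%:R / M%:R.
Definition cell_hi c (i : I) : R := -1 + 2 * ((c i).1 + (c i).2)%:R / M%:R.
Definition cell_box c : set {ptws I -> R} := box (cell_lo c) (cell_hi c).

(** The first condition excludes intervals [[M, M + 1]], which leave the cube; the second puts the
    cell in a facet. *)
Definition sphere_cell c : bool :=
  [forall i, ((c i).1 + (c i).2 <= M)%N] &&
  [exists i, ~~ (c i).2 && (((c i).1 == 0 :> nat) || ((c i).1 == M :> nat))].

Lemma cell_boxP c (t : {ptws I -> R}) :
  cell_box c t <-> forall i, ((c i).1%:R <= (t i + 1) * M%:R / 2) /\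
    ((t i + 1) * M%:R / 2 <= ((c i).1 + (c i).2)%:R).
Proof.
have M1 : 0 < M%:R :> R by rewrite ltr0n.
have loE (x y : R) : (-1 + 2 * x / M%:R <= y) = (x <= (y + 1) * M%:R / 2).
  by rewrite -lerBrDl opprK ler_pdivrMr // ler_pdivlMr // mulrC.
have hiE (x y : R) : (y <= -1 + 2 * x / M%:R) = ((y + 1) * M%:R / 2 <= x).
  by rewrite -lerBlDl opprK ler_pdivlMr // ler_pdivrMr // (mulrC x).
split=> tc i; have := tc i; rewrite /cell_lo /cell_hi loE hiE;
  first by move/andP.
by case=> -> ->.
Qed.

Lemma cell_lo_hi c i : (cell_lo c i < cell_hi c i) = (c i).2.
Proof.
have M1 : 0 < M%:R :> R by rewrite ltr0n.
rewrite /cell_lo /cell_hi ltrD2l ltr_pM2r ?invr_gt0 // ltr_pM2l //.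
by rewrite ltr_nat -[X in (X < _)%N]addn0 ltn_add2l; case: (c i).2.
Qed.

Lemma cell_lo_le_hi c i : cell_lo c i <= cell_hi c i.
Proof.
rewrite /cell_lo /cell_hi lerD2l ler_wpM2r ?invr_ge0 // ler_wpM2l //.
by rewrite ler_nat leq_addr.
Qed.

Lemma cell_dimE c : #|[pred i | cell_lo c i < cell_hi c i]| = cell_dim c.
Proof. by apply: eq_card => i; rewrite !inE cell_lo_hi. Qed.

Lemma cell_dim_lt c : sphere_cell c -> (cell_dim c < #|I|)%N.
Proof.
case/andP=> _ /existsP[i /andP[ei _]]; rewrite ltn_neqAle max_card andbT.
apply: contra ei => /eqP ce.
have /subset_cardP/(_ (subset_predT _))/(_ i) := ce.
by rewrite !inE => ->.
Qed.

Lemma cell_sub_sphere c : sphere_cell c -> cell_box c `<=` ssphere R I.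
Proof.
have M1 : 0 < M%:R :> R by rewrite ltr0n.
case/andP=> /forallP cM /existsP[i /andP[/negbTE ei ai]] t /cell_boxP tc; split.
  move=> j; have [lo hi] := tc j; have := cM j; rewrite -(ler_nat R) => le.
  have := le_trans hi le; have := le_trans (ler0n _ _) lo.
  rewrite ler_pdivlMr // ler_pdivrMr // mul0r pmulr_lge0 // [M%:R * 2]mulrC
    ler_pM2r //.
  lra.
exists i; split; first by lra.
have [] := tc i; rewrite ei addn0 => lo hi.
have {lo hi} : (t i + 1) * M%:R / 2 = (c i).1%:R by apply/eqP;
  rewrite eq_le lo hi.
case/orP: ai => /eqP -> te; [left|right].
  have /eqP : (t i + 1) * M%:R = 0 by lra.
  by rewrite mulf_eq0 (gt_eqF M1) orbF => /eqP; lra.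
apply: (mulIf (lt0r_neq0 M1)); lra.
Qed.

Lemma cell_small c (s t : {ptws I -> R}) :
  cell_box c s -> cell_box c t -> forall i, `|s i - t i| <= 2 / M%:R.
Proof.
have M1 : 0 < M%:R :> R by rewrite ltr0n.
move=> /cell_boxP sc /cell_boxP tc i; have [s1 s2] := sc i;
  have [t1 t2] := tc i.
rewrite ler_pdivlMr //.
have e1 : (c i).2%:R <= 1 :> R by rewrite lern1 leq_b1.
rewrite natrD in s2 t2.
have -> : `|s i - t i| * M%:R = `|(s i + 1) * M%:R - (t i + 1) * M%:R|.
  by rewrite -mulrBl normrM [`|M%:R|]ger0_norm //; congr (`|_| * _); lra.
rewrite ler_norml; apply/andP; split; lra.
Qed.

Lemma sphere_cell_cover (t : {ptws I -> R}) : ssphere R I t ->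
  exists2 c, sphere_cell c & cell_box c t.
Proof.
have M1 : 0 < M%:R :> R by rewrite ltr0n.
case=> tb [i0 [_ ti0]].
pose x i := (t i + 1) * M%:R / 2.
have x0 i : 0 <= x i <= M%:R by have := tb i; rewrite /x; nra.
(* Coordinates equal to 1 or -1 get a degenerate interval, so [i0] puts the cell in a facet. The
   others get their integer part, which is less than [M]. *)
pose a i : nat := if t i == 1 then M else if t i == -1 then 0%N else
  Num.truncn (x i).
pose e i := (t i != 1) && (t i != -1).
have aM i : (a i < M.+1)%N.
  rewrite /a; case: eqP => // _; case: eqP => // _; rewrite ltnS.
  by rewrite -(ler_nat R)
    (le_trans _ (andP (x0 i)).2) // truncn_le (andP (x0 i)).1.
pose c : cell := [ffun i => (Ordinal (aM i), e i)].
have ac i : ((a i)%:R <= x i <= (a i + e i)%:R) && (a i + e i <= M)%N.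
  rewrite /e /a; case: eqP => [ti|ti1] /=.
    by rewrite addn0 leqnn andbT /x ti; lra.
  case: eqP => [ti|tiN1] /=; first by rewrite /x ti; apply/andP; split=> //;
    lra.
  have /andP[tlo thi] := tb i.
  have xM : x i < M%:R by rewrite /x ltr_pdivrMr // mulrC ltr_pM2l //; lra.
  have /andP[tr1 tr2] := truncn_itv (andP (x0 i)).1.
  rewrite addn1 tr1 (ltW tr2) /= -(ltr_nat R).
  exact: le_lt_trans tr1 xM.
exists c.
  apply/andP; split; first by apply/forallP => i; rewrite ffunE;
    case/andP: (ac i).
  apply/existsP; exists i0; rewrite ffunE /= /e /a.
  have N11 : (-1 == 1 :> R) = false by apply/eqP; lra.
  by case: ti0 => ->; rewrite ?N11 !eqxx ?orbT.
by apply/cell_boxP => i; rewrite ffunE /=; have /andP[/andP[-> ->]] := ac i.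
Qed.

(** Off the boundary of [c], each nondegenerate coordinate of [t] lies strictly between consecutive
    grid values, which forces the same interval on [c']. By the comparison of dimensions [c'] has no
    other nondegenerate coordinate, and the degenerate ones are determined by [t]. *)
Lemma cell_sep c c' (t : {ptws I -> R}) : cell_box c t -> cell_box c' t ->
  c' != c -> (cell_dim c' <= cell_dim c)%N ->
  box_boundary (cell_lo c) (cell_hi c) t.
Proof.
move=> tc tc' ncc' dim; apply: contrapT => ntc; case/negP: ncc'.
have M1 : 0 < M%:R :> R by rewrite ltr0n.
have strict i : (c i).2 -> (c i).1%:R < (t i + 1) * M%:R / 2 < ((c i).1 + 1)%:R.
  move=> ei; have [lo hi] := (cell_boxP c t).1 tc i.
  rewrite ei in hi.
  apply/andP; split; rewrite lt_neqAle ?lo ?hi andbT; apply/negP => /eqP te;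
    apply: ntc; split=> //; exists i; rewrite cell_lo_hi ei; split=> //.
    by left; rewrite /cell_lo te; field; rewrite gt_eqF.
  by right; rewrite /cell_hi ei -te; field; rewrite gt_eqF.
have tc'i := (cell_boxP c' t).1 tc'; have tci := (cell_boxP c t).1 tc.
have e_eq i : (c i).2 -> c' i = c i.
  move=> ei; have /andP[lo hi] := strict i ei; have [lo' hi'] := tc'i i.
  have := le_lt_trans lo' hi; have := lt_le_trans lo hi';
    rewrite !ltr_nat addn1.
  rewrite ltnS => h1 h2.
  case: (c' i) h1 h2 ei => a' e'; case: (c i) => a e /= h1 h2 ->.
  have [ea ee] : a' = a :> nat /\ e' by case: e' h1 => h1; split=> //; lia.
  by rewrite ee; congr pair; apply: val_inj.
have sub : [pred i | (c i).2] \subset [pred i | (c' i).2].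
  by apply/fintype.subsetP => i; rewrite !inE => ei; rewrite e_eq.
have eqp : [pred i | (c i).2] =i [pred i | (c' i).2].
  by apply/subset_cardP => //; apply/eqP; rewrite eqn_leq subset_leq_card.
apply/eqP/ffunP => i; case ei: (c i).2; first exact: e_eq.
have ei' : (c' i).2 = false by have := eqp i; rewrite !inE ei.
have [lo hi] := tci i; have [lo' hi'] := tc'i i.
rewrite ei addn0 in hi; rewrite ei' addn0 in hi'.
have ea : (c' i).1 = (c i).1 :> nat.
  by apply/eqP; rewrite eqn_leq -!(ler_nat R) (le_trans lo' hi)
    (le_trans lo hi').
case: (c' i) ei' ea {lo hi lo' hi'} => a' e'; case: (c i) ei => a e /= -> -> ea.
by congr pair; apply: val_inj.
Qed.

(** Collapse a nondegenerate direction to the end on which [t] lies. The coordinate [j] that keeps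
    [c] in the sphere is untouched. *)
Lemma cell_face c (t : {ptws I -> R}) : sphere_cell c ->
  box_boundary (cell_lo c) (cell_hi c) t ->
  exists c', [/\ sphere_cell c', (cell_dim c' < cell_dim c)%N,
    cell_box c' `<=` cell_box c & cell_box c' t].
Proof.
move=> /andP[/forallP cM /existsP[j /andP[ej aj]]] [tc [i [+ ti]]].
rewrite cell_lo_hi => ei.
pose up := t i == cell_hi c i.
have aM : ((c i).1 + up < M.+1)%N.
  by rewrite ltnS (leq_trans _ (cM i)) // leq_add2l ei leq_b1.
pose c' : cell := [ffun k => if k == i then (Ordinal aM, false) else c k].
have c'i : c' i = (Ordinal aM, false) by rewrite ffunE eqxx.
have c'k k : k != i -> c' k = c k by move=> ki; rewrite ffunE (negbTE ki).
have ji : j != i by apply: contra ej => /eqP ->.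
exists c'; split.
- apply/andP; split; last by apply/existsP; exists j; rewrite c'k // ej.
  apply/forallP => k; have [->|ki] := eqVneq k i; first by rewrite c'i addn0.
  by rewrite c'k.
- apply: proper_card; apply/fintype.properP; split.
    apply/fintype.subsetP => k; rewrite !inE.
    by have [->|ki] := eqVneq k i; rewrite ?c'i // c'k.
  by exists i; rewrite !inE // c'i.
- move=> s /cell_boxP sc'; apply/cell_boxP => k.
  have := sc' k; have [->|ki] := eqVneq k i; last by rewrite c'k.
  rewrite c'i /= addn0 ei => -[lo hi]; split.
    by apply: le_trans lo; rewrite ler_nat leq_addr.
  by apply: le_trans hi _; rewrite ler_nat leq_add2l leq_b1.
- move=> k; have [->|ki] := eqVneq k i; last first.
    by rewrite /cell_lo /cell_hi c'k //; exact: tc.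
  rewrite /cell_lo /cell_hi c'i /= addn0.
  suff -> : t i = -1 + 2 * ((c i).1 + up)%:R / M%:R by rewrite lexx.
  rewrite /up; case: eqP => [->|ne]; first by rewrite /cell_hi ei.
  by case: ti => // ->; rewrite addn0.
Qed.

End Grid.

(** * Unions *)

Section Union.
Context {R : realType} {V : finType}.
Implicit Types (I : finType) (X : set (V -> R)).

Lemma extendable_eq I (lo hi : I -> R) X (f g : {ptws I -> R} -> V -> R) :
  (forall t, box_boundary lo hi t -> f t = g t) ->
  extendable lo hi X f -> extendable lo hi X g.
Proof. by move=> fg [h mh hf]; exists h => // t tb; rewrite hf // fg. Qed.

Lemma extendableW I (lo hi : I -> R) X X' (f : {ptws I -> R} -> V -> R) :
  X `<=` X' -> extendable lo hi X f -> extendable lo hi X' f.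
Proof. by move=> XX' [h mh hf]; exists h => //;
  apply: map_onW mh => // t _ /XX'. Qed.

Lemma card_option_pred I (P : pred (option I)) :
  #|P| = (P None + #|[pred i | P (Some i)]|)%N.
Proof.
rewrite (cardD1 None); congr addn.
rewrite -[RHS](fintype.card_image (@Some_inj _)); apply: eq_card => -[i|];
  rewrite !inE /=.
  by rewrite (fintype.mem_image (@Some_inj _)).
by apply/esym/negbTE/fintype.imageP => -[].
Qed.

(* A homotopy of [f] into [X2], stationary on the cells that [f] maps to [X2]
   and inside [X1] on the others, is built cell by cell. *)
Lemma extendable_union d X1 X2 I M (f : {ptws I -> R} -> V -> R) :
  fills_spheres X1 d -> fills_spheres X2 d ->
  ((0 < d)%N -> fills_spheres (X1 `&` X2) d.-1) ->
  (#|I| <= d)%N -> (0 < M)%N -> map_on (ssphere R I) (X1 `|` X2) f ->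
  (forall c : cell I M, sphere_cell c ->
     cell_box c `<=` f @^-1` X1 \/ cell_box c `<=` f @^-1` X2) ->
  extendable (fun _ : I => -1) (fun=> 1) (X1 `|` X2) f.
Proof.
move=> fill1 fill2 fill12 dI M0 mf f12.
pose C : finType := {c : cell I M | sphere_cell c}.
pose cbox (c : C) := @cell_box R I M (val c).
(* Prisms over the cells. Dimension is that of the base, and bottom and top are not cells, so
   [cell_boundary F dim c] is the lateral wall of the prism ([bdF] and [Fbd]). *)
pose F (c : C) : set {ptws option I -> R} :=
  box (at_time 0 (cell_lo (val c))) (at_time 1 (cell_hi (val c))).
pose dim (c : C) := cell_dim (val c).
have FP c t : F c t <-> cbox c (spatial t) /\ 0 <= t None <= 1.
  split=> [tc|[tc t01] [i|]] //; last exact: tc.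
  by split=> [i|]; [exact: (tc (Some i))|exact: (tc None)].
(* The hypotheses of the last two conditions pass to the faces of [c], so these conditions are
   available on the wall of the prism to be filled. *)
pose P (c : C) (h : {ptws option I -> R} -> V -> R) := [/\
  forall t, F c t -> t None = 0 -> h t = f (spatial t),
  forall t, F c t -> t None = 1 -> X2 (h t),
  cbox c `<=` f @^-1` X1 -> forall t, F c t -> X1 (h t) &
  cbox c `<=` f @^-1` X2 -> forall t, F c t -> h t = f (spatial t)].
pose cbd (c : C) := @box_boundary R I (cell_lo (val c)) (cell_hi (val c)).
have clF c : closed (F c) by exact: closed_box.
have subF c c' : F c' `<=` F c -> cbox c' `<=` cbox c.
  move=> sF t tc'; have /sF/FP[] // : F c' (at_time 0 t).
  by apply/FP; rewrite /= lexx ler01.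
have bdF c t : cell_boundary F dim c t ->
    cbd c (spatial t).
  case=> c' [dc' sF] tc'; have [tc _] := (FP c t).1 (sF _ tc').
  have [tc'' _] := (FP c' t).1 tc'.
  apply: (cell_sep M0 tc tc''); last exact: ltnW.
  by apply: contraTneq dc'; rewrite /dim => ->; rewrite ltnn.
have Fbd c t : cbd c (spatial t) ->
    0 <= t None <= 1 -> cell_boundary F dim c t.
  move=> tb t01; have [c' [oc' dc' sc' tc']] := cell_face M0 (valP c) tb.
  exists (Sub c' oc') => /=; last exact/FP.
  split=> // s /FP[/= sb s01]; apply/FP; split=> //; exact: sc'.
have fspatial c : map_on (F c) (X1 `|` X2) (f \o @spatial R I).
  apply: map_on_comp mf => [t /FP[tc _]|]; last exact: cont_on_spatial.
  exact: cell_sub_sphere (valP c) _ tc.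
have [||||h mh Ph] := @skeleton_extension R V _ C F dim P.
- exact: clF.
- move=> c c' t nc dc tc tc'; have [tcb t01] := (FP c t).1 tc.
  have [tcb' _] := (FP c' t).1 tc'.
  by apply: Fbd => //; apply: (cell_sep M0 tcb tcb').
- move=> c h h' hh' [P0 P1 P2 P3]; split.
  + by move=> t Ft t0; rewrite -hh' // P0.
  + by move=> t Ft t1; rewrite -hh' //; exact: P1.
  + by move=> c1 t Ft; rewrite -hh' //; exact: P2.
  + by move=> c2 t Ft; rewrite -hh' // P3.
- move=> c h mh Ph.
  have Pbd t : cell_boundary F dim c t -> exists c',
      [/\ P c' h, cbox c' `<=` cbox c & F c' t].
    case=> c' [dc' sF] Ft; exists c'; split=> //; first exact: Ph.
    exact: subF.
  have [c2|nc2] := pselect (cbox c `<=` f @^-1` X2).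
    exists (f \o @spatial R I); split; first by apply: map_onW (fspatial c).
      move=> t /Pbd[c' [[_ _ _ P3] sc' Ft]]; rewrite P3 // => s /sc'; exact: c2.
    split=> // [t /FP[tc _] _|c1 t /FP[tc _]]; [exact: c2|exact: c1].
  have c1 : cbox c `<=` f @^-1` X1.
    by have [] := f12 (val c) (valP c).
  have bd1 t : cell_boundary F dim c t -> X1 (h t).
    move=> /Pbd[c' [[_ _ P2 _] sc' Ft]]; apply: P2 => // s /sc'; exact: c1.
  have d0 : (0 < d)%N.
    exact: leq_trans (leq_ltn_trans (leq0n _) (cell_dim_lt (valP c))) dI.
  have cdim : (dim c <= d.-1)%N.
    by rewrite -ltnS prednK // (leq_trans (cell_dim_lt (valP c))).
  have lohi i : cell_lo (val c) i <= cell_hi (val c) i :> R :=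
    cell_lo_le_hi _ _.
  pose lo s : {ptws option I -> R} := at_time s (cell_lo (val c)).
  pose hi s : {ptws option I -> R} := at_time s (cell_hi (val c)).
  have sides s s' t : box (lo s) (hi s') t ->
      (exists i, cell_lo (val c) i < cell_hi (val c) i :> R /\
        (t (Some i) = cell_lo (val c) i \/ t (Some i) = cell_hi (val c) i)) ->
      cbd c (spatial t).
    by move=> tb ti; split; [move=> i; exact: (tb (Some i))|exact: ti].
  (* The upper rim of the wall is mapped to [X1], like the wall, and to [X2], being at time 1. The
     top has dimension [dim c <= d.-1], so it is filled in [X1] and [X2] at once. *)
  have [|||k mk kh] :=
      @fills_spheres_box R V (X1 `&` X2) d.-1 _ (lo 1) (hi 1) h (fill12 d0).
  - by case=> [i|] //=.
  - by rewrite card_option_pred /= ltxx add0n cell_dimE.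
  - apply: map_onW mh => t.
      move=> [tb [[i|] [/= li ti]]]; last by rewrite ltxx in li.
      apply: Fbd; first by apply: (sides 1 1) => //; exists i.
      by have /= /andP[t1 ->] := tb None; rewrite (le_trans ler01 t1).
    move=> [tb [[i|] [/= li ti]]] _; last by rewrite ltxx in li.
    have tbd : cell_boundary F dim c t.
      apply: Fbd; first by apply: (sides 1 1) => //; exists i.
      by have /= /andP[t1 ->] := tb None; rewrite (le_trans ler01 t1).
    split; first exact: bd1.
    have [c' [[_ P1 _ _] sc' Ft]] := Pbd t tbd.
    apply: P1 => //; apply/eqP; rewrite eq_le.
    by have /= /andP[-> ->] := tb None.
  pose B0 := F c `&` [set t | t None = 0].
  pose B1 := F c `&` [set t | t None = 1].
  (* The boundary of the prism: [f] on the bottom, the filling [k] on the top, [h] on the wall. All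
     of it lies in [X1], and the prism has dimension [(dim c).+1 <= d], so [X1] fills it. *)
  pose g (t : {ptws option I -> R}) := if t None == 0 then f (spatial t) else
              if t None == 1 then k t else h t.
  have B1E t : B1 t -> box (lo 1) (hi 1) t.
    move=> [tF /= t1] [i|] /=; first exact: (tF (Some i)).
    by rewrite t1 lexx.
  have g0 t : t None = 0 -> g t = f (spatial t) by move=> t0;
    rewrite /g t0 eqxx.
  have g1 t : t None = 1 -> g t = k t.
    by move=> t1; rewrite /g t1 eqxx oner_eq0.
  have gh t : cell_boundary F dim c t -> g t = h t.
    move=> tbd; have [c' [[P0 _ _ _] sc' Ft]] := Pbd t tbd.
    rewrite /g; case: eqP => [t0|_]; first by rewrite P0.
    case: eqP => // t1; rewrite kh //; have tb := bdF c t tbd.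
    have [t' [i [li ti]]] := tb.
    split; last by exists (Some i).
    by move=> [j|] /=; [exact: t'|rewrite t1 lexx].
  have mg0 : map_on B0 X1 g.
    apply: (@map_on_eq _ _ {ptws option I -> R} _ _ (f \o @spatial R I)).
      by move=> t [_ /= t0]; rewrite g0.
    apply: map_onW (fspatial c) => [t [] //|t [/FP[tc _] _] _].
    exact: c1.
  have mg1 : map_on B1 X1 g.
    apply: (@map_on_eq _ _ _ _ _ k).
      by move=> t [_ /= t1]; rewrite g1.
    by apply: map_onW mk => [t /B1E //|t _ []].
  have mgh : map_on (cell_boundary F dim c) X1 g.
    apply: (@map_on_eq _ _ _ _ _ h); first by move=> t tbd; rewrite gh.
    by apply: map_onW mh => // t tbd _; exact: bd1.
  have clB s : closed (F c `&` [set t | t None = s]).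
    by apply: closedI; [exact: clF|exact: closed_coord_eq].
  have clbd : closed (cell_boundary F dim c).
    have -> : cell_boundary F dim c = [set t | exists2 c',
        (dim c' < dim c)%N && `[< F c' `<=` F c >] & F c' t].
      apply/seteqP; split=> t [c' Hc' tc']; exists c' => //.
        by case: Hc' => -> sF; apply/asboolP.
      by case/andP: Hc' => ? /asboolP.
    by apply: closed_exists2.
  have mg := map_onU (closedU (clB 0) (clB 1)) clbd
    (map_onU (clB 0) (clB 1) mg0 mg1) mgh.
  have boundaryE t : box_boundary (lo 0) (hi 1) t ->
      ((B0 `|` B1) `|` cell_boundary F dim c) t.
    move=> [tb [[i|] [/= li ti]]].
      right; apply: Fbd; first by apply: (sides 0 1) => //; exists i.
      exact: (tb None).
    by left; case: ti => ?; [left|right].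
  have [|||k' mk' kg] := @fills_spheres_box R V X1 d _ (lo 0) (hi 1) g fill1.
  - by case=> [i|] //=; exact: ler01.
  - rewrite card_option_pred /= ltr01 add1n cell_dimE //.
    by rewrite -[d]prednK // ltnS.
  - by apply: (map_onW boundaryE _ mg).
  have bdlohi t : F c t -> t None = 0 \/ t None = 1 ->
    box_boundary (lo 0) (hi 1) t.
    by move=> Ft t01; split=> //; exists None; rewrite /= ltr01.
  exists k'; split.
  + exact: map_onW mk'.
  + move=> t tbd; rewrite kg ?gh //.
    have [_ [i [li ti]]] := bdF c t tbd.
    have [c' [_ sF] Ft] := tbd.
    by split; [exact: sF|exists (Some i)].
  + split=> [t Ft t0|t Ft t1|_ t Ft|//].
    * by rewrite kg ?g0 //; apply: bdlohi => //; left.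
    * rewrite kg ?g1 //; last by apply: bdlohi => //; right.
      by have [_ /(_ t (B1E t (conj Ft t1)))[]] := mk.
    * by have [_] := mk'; exact.
have cylE t : @cylinder R I t -> exists c, F c t.
  move=> [ts t01]; have [c oc tc] := sphere_cell_cover M0 ts.
  by exists (Sub c oc); apply/FP.
have hX c t : F c t -> (X1 `|` X2) (h t).
  move=> Ft; have [_ _ P2 P3] := Ph c.
  have [c1|c2] := f12 (val c) (valP c); first by left; exact: P2.
  by right; rewrite P3 //; apply: c2; have [] := (FP c t).1 Ft.
have mH : map_on (@cylinder R I) (X1 `|` X2) h.
  apply: map_onW mh => [t /cylE//|t /cylE[c Ft] _]; exact: hX Ft.
apply: (@extendable_eq _ _ _ _ (fun t => h (at_time 0 t))).
  move=> t ts; have [|c Ft] := cylE (at_time 0 t).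
    by split; [exact: ts|rewrite /= lexx ler01].
  by have [P0 _ _ _] := Ph c; rewrite P0.
(* The homotopy starts at [f] and ends in [X2], where the final map extends over the cube. *)
apply: homotopy_extendable => //.
apply: (@extendableW _ _ _ X2) => [p|]; first by right.
apply: fill2 => //.
have scyl t : ssphere R I t -> @cylinder R I (at_time 1 t).
  by move=> ts; split; [exact: ts|rewrite /= lexx ler01].
have [ch _] : map_on (ssphere R I) (X1 `|` X2) (h \o @at_time R I 1).
  apply: map_on_comp mH => //.
  apply: cont_on_at_time; first exact: cont_on_cst.
  by apply: cont_on_ptws => i; exact: cont_on_coord.
split=> // t ts; have [c Ft] := cylE _ (scyl t ts).
by have [_ P1 _ _] := Ph c; apply: P1.
Qed.

End Union.

(** * Uniform continuity on compact sets *)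

Section UniformContinuity.
Context {R : realType}.
Implicit Types I : finType.

(** For the direct implication, the filter generated by the sup-norm balls converges to [x] in each
    coordinate, hence pointwise. The converse intersects finitely many coordinate conditions, [I]
    being finite. *)
Lemma nbhs_ptws_box I (x : {ptws I -> R}) (N : set {ptws I -> R}) :
  nbhs x N <->
  exists2 d : R, 0 < d &
    forall y : {ptws I -> R}, (forall i, `|x i - y i| < d) -> N y.
Proof.
split=> [xN|[d d0 dN]].
  pose F : set_system {ptws I -> R} := [set S | exists2 d : R, 0 < d &
    forall y : {ptws I -> R}, (forall i, `|x i - y i| < d) -> S y].
  have FF : Filter F.
    split; first by exists 1.
      move=> P Q [d d0 dP] [e e0 eQ]; exists (Num.min d e);
        first by rewrite lt_min d0.
      move=> y xy; split; [apply: dP => i|apply: eQ => i].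
        by have := xy i; rewrite lt_min => /andP[].
      by have := xy i; rewrite lt_min => /andP[].
    by move=> P Q PQ [d d0 dP]; exists d => // y /dP /PQ.
  suff : F --> x by apply.
  apply: cvg_ptws => i; apply/cvgrPdist_lt => e e0.
  by exists e => // y; exact.
apply: (@filterS _ _ _ [set y : {ptws I -> R} | forall i, `|x i - y i| < d]).
  exact: dN.
apply: (@filter_forall _ I
  (fun i (y : {ptws I -> R}) => `|x i - y i| < d) (nbhs x)) => i.
have /cvgrPdist_lt : (fun y : {ptws I -> R} => y i) @ x --> x i.
  exact: (@proj_continuous I (fun=> R : topologicalType) i x).
exact.
Qed.

(** Heine-Cantor, with the modulus of continuity given as the mesh of a grid. Compactness enters as
    the near-covering property, with the filter of large [M]. *)
Lemma compact_unif_grid I (J : finType) (A : set {ptws I -> R})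
    (f : {ptws I -> R} -> J -> R) (e : R) :
  compact A -> (forall j, cont_on A (fun t => f t j)) -> 0 < e ->
  exists2 M : nat, (0 < M)%N & forall s t : {ptws I -> R}, A s -> A t ->
    (forall i, `|s i - t i| <= 2 / M%:R) -> forall j, `|f s j - f t j| < e.
Proof.
move=> /compact_near_coveringP/near_covering_withinP cA cf e0.
pose P (M : nat) (s : {ptws I -> R}) := forall t : {ptws I -> R}, A t ->
  (forall i, `|s i - t i| <= 2 / M.+1%:R) -> forall j, `|f s j - f t j| < e.
suff [N _ /(_ N (leqnn N)) PN] : \forall M \near \oo, A `<=` P M.
  by exists N.+1 => // s t As; exact: PN.
apply: cA => x Ax.
have /nbhs_ptws_box[d d0 dN] : \forall y \near x, A y ->
  forall j, `|f x j - f y j| < e / 2.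
  have /(@filter_forall _ J (fun j (y : {ptws I -> R}) => A y ->
    `|f x j - f y j| < e / 2)
      (nbhs x)) near_f : forall j, \forall y \near x, A y ->
        `|f x j - f y j| < e / 2.
    move=> j; have /cont_onP/(_ x Ax)/cvgrPdist_lt := cf j.
    by apply; rewrite divr_gt0.
  by apply: filterS near_f => y fy Ay j; exact: fy.
(* If [s] is within [d / 4] of [x] and the mesh is less than [d / 2], then [t] is within [3 * d / 4]
   of [x]. *)
have d4 : 0 < d / 4 by rewrite divr_gt0.
exists ([set y : {ptws I -> R} | forall i, `|x i - y i| < d / 4],
        [set M | M.+1%:R^-1 < d / 4]) => /=.
  split; first by apply/nbhs_ptws_box; exists (d / 4).
  exact: (near_infty_natSinv_lt (PosNum d4)).
move=> [s M] /= [xs Md] As t At st j.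
have fs : `|f x j - f s j| < e / 2.
  by apply: dN => // i; have := xs i; lra.
have ft : `|f x j - f t j| < e / 2.
  apply: dN => // i; have := xs i.
  have : `|s i - t i| < 2 * (d / 4) by apply: le_lt_trans (st i) _;
    rewrite ltr_pM2l.
  have -> : x i - t i = (x i - s i) + (s i - t i) by rewrite addrA subrK.
  by have := ler_normD (x i - s i) (s i - t i); lra.
have -> : f s j - f t j = (f x j - f t j) - (f x j - f s j) by ring.
by apply: le_lt_trans (ler_normB _ _) _; lra.
Qed.

End UniformContinuity.

(** * Geometric complexes *)

Section Complexes.
Context {R : realType} {V : finType}.
Implicit Types (K : {set {set V}}) (p : V -> R).

(** The carrier of the realization as a bare set of functions, the form in which [map_on] uses
    it. *)
Definition geometric K : set (V -> R) := [set p | [/\ forall v, 0 <= p v,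
  \sum_v p v = 1 & finset (fun v => p v != 0) \in K]].

Definition down_closed K : Prop :=
  forall s t : {set V}, s \in K -> t \subset s -> t != finset.set0 -> t \in K.

Lemma geometricU K L : geometric (K :|: L) = geometric K `|` geometric L.
Proof.
apply/seteqP; split=> p.
  by move=> [p0 p1]; rewrite inE => /orP[]; [left|right].
by case=> -[p0 p1 pK]; split=> //; rewrite inE pK ?orbT.
Qed.

Lemma geometricI K L : geometric (K :&: L) = geometric K `&` geometric L.
Proof.
apply/seteqP; split=> p; last first.
  by move=> [[p0 p1 pK] [_ _ pL]]; split=> //; rewrite inE pK.
by move=> [p0 p1]; rewrite inE => /andP[].
Qed.

Lemma support_neq0 p : \sum_v p v = 1 ->
  finset (fun v => p v != 0) != finset.set0.
Proof.
move=> p1; apply: contra_eq_neq p1 => /setP p0.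
rewrite big1 => [|v _]; first by rewrite eq_sym oner_neq0.
by have := p0 v; rewrite !inE => /negbFE/eqP.
Qed.

Lemma geometric_support K s p : down_closed K -> s \in K ->
  (forall v, 0 <= p v) -> \sum_v p v = 1 -> (forall v, p v != 0 -> v \in s) ->
  geometric K p.
Proof.
move=> dK sK p0 p1 ps; split=> //; apply: (dK s) => //;
  last exact: support_neq0.
by apply/fintype.subsetP => v; rewrite inE => /ps.
Qed.

(** Subtract [e] from the barycentric coordinates, cut off at 0 and normalise. The support can only
    decrease, to coordinates larger than [e]. *)
Definition shrink (e : R) p : V -> R :=
  fun v => Num.max (p v - e) 0 / \sum_u Num.max (p u - e) 0.

(** Below [1 / #|V|], hence some coordinate exceeds it and the normalising sum stays positive. *)
Definition shrink_max : R := #|V|.+1%:R^-1.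

Lemma shrink_sum_gt0 e p : \sum_v p v = 1 -> e <= shrink_max ->
  0 < \sum_u Num.max (p u - e) 0.
Proof.
move=> p1 ee; apply: (@lt_le_trans _ _ (\sum_u (p u - e))).
  rewrite sumrB p1 subr_gt0 sumr_const.
  apply: (@le_lt_trans _ _ (shrink_max *+ #|V|));
    first by rewrite lerMn2r ee orbT.
  by rewrite -mulr_natr /shrink_max mulrC ltr_pdivrMr ?ltr0n // mul1r ltr_nat.
by apply: ler_sum => u _; rewrite le_max lexx.
Qed.

Lemma shrink_supp e p v : shrink e p v != 0 -> e < p v.
Proof. by apply: contraNT; rewrite -leNgt /shrink => pe;
  rewrite max_r ?mul0r // subr_le0. Qed.

Lemma shrink_simplex e p : \sum_v p v = 1 -> e <= shrink_max ->
  (forall v, 0 <= shrink e p v) /\ \sum_v shrink e p v = 1.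
Proof.
move=> p1 ee; have s0 := shrink_sum_gt0 p1 ee; split=> [v|].
  by rewrite divr_ge0 ?(ltW s0) // le_max lexx orbT.
by rewrite -mulr_suml divff // gt_eqF.
Qed.

Lemma shrink0 p : (forall v, 0 <= p v) -> \sum_v p v = 1 -> shrink 0 p = p.
Proof.
move=> p0 p1; have m u : Num.max (p u - 0) 0 = p u by rewrite subr0 max_l.
apply/funext => v; rewrite /shrink m.
by under eq_bigr do rewrite m; rewrite p1 divr1.
Qed.

Lemma shrink_cont (T : topologicalType) (A : set T) (e : T -> R) (f : T ->
  V -> R) v :
  cont_on A e -> (forall v, cont_on A (fun t => f t v)) ->
  (forall t, A t -> \sum_v f t v = 1 /\ e t <= shrink_max) ->
  cont_on A (fun t => shrink (e t) (f t) v).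
Proof.
move=> ce cf fe.
have cmax u : cont_on A (fun t => Num.max (f t u - e t) 0).
  apply: cont_on_max; last exact: cont_on_cst.
  by apply: cont_onD => //; exact: cont_onN.
apply: cont_onM => //; apply: cont_onV; first exact: cont_on_sum.
by move=> t /fe[p1 ee]; rewrite gt_eqF // shrink_sum_gt0.
Qed.

(* Shrinking a map moves it, within the carriers, to a map sending every cell of
   a fine enough grid to a single simplex. *)
Lemma fills_spheresU d K1 K2 : down_closed K1 -> down_closed K2 ->
  fills_spheres (geometric K1) d -> fills_spheres (geometric K2) d ->
  ((0 < d)%N -> fills_spheres (geometric (K1 :&: K2)) d.-1) ->
  fills_spheres (geometric (K1 :|: K2)) d.
Proof.
move=> dK1 dK2 fill1 fill2; rewrite geometricI => fill12 I f dI mf.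
have e0 : 0 < shrink_max by rewrite invr_gt0 ltr0n.
have dK : down_closed (K1 :|: K2).
  move=> s t; rewrite !inE => /orP[sK|sK] st t0; first by rewrite (dK1 s).
  by rewrite (dK2 s) ?orbT.
have [cf Kf] := mf.
have compact_sphere : compact (ssphere R I).
  apply: (subclosed_compact _ (@compact_box R I (fun=> -1) (fun=> 1)));
    first exact: closed_box_boundary.
  by move=> t [].
have [M M0 fM] := compact_unif_grid compact_sphere cf e0.
pose H (t : {ptws option I -> R}) :=
  shrink (t None * shrink_max) (f (spatial t)).
have sph t : @cylinder R I t -> ssphere R I (spatial t) by case.
have mH : map_on (@cylinder R I) (geometric (K1 :|: K2)) H.
  have le_max t : @cylinder R I t -> t None * shrink_max <= shrink_max.
    by move=> [_ /andP[_ t1]]; rewrite ler_piMl // (ltW e0).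
  split=> [v|t ct].
    apply: shrink_cont => [|u|t ct].
    - by apply: cont_onM; [exact: cont_on_coord|exact: cont_on_cst].
    - exact: (cont_on_comp sph (@cont_on_spatial R I _) (cf u)).
    - by have [_ p1 _] := Kf _ ct.1; split=> //; exact: le_max.
  have [p0 p1 pK] := Kf _ ct.1.
  have [s0 s1] := shrink_simplex p1 (le_max t ct).
  apply: (geometric_support dK pK) => // v /shrink_supp; rewrite inE => pv.
  rewrite gt_eqF // (le_lt_trans _ pv) // mulr_ge0 ?(ltW e0) //.
  by have [_ /andP[]] := ct.
apply: (@extendable_eq _ _ _ _ _ _ (fun t => H (at_time 0 t))).
  by move=> t ts; rewrite /H mul0r; have [p0 p1 _] := Kf t ts; rewrite shrink0.
apply: homotopy_extendable => //.
rewrite geometricU.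
apply: (extendable_union fill1 fill2 fill12 dI M0); rewrite -?geometricU.
  apply: (@map_on_comp _ _ {ptws I -> R} _ _ (@cylinder R I) _
    (@at_time R I 1) H) => //.
    by move=> t ts; split; [exact: ts|rewrite /= lexx ler01].
  apply: cont_on_at_time; first exact: cont_on_cst.
  by apply: cont_on_ptws => i; exact: cont_on_coord.
(* The corner [s0] serves as reference for the cell. If [v] survives the shrinking at [t], then
   [f t v] exceeds [shrink_max], and by the choice of [M] the value [f s0 v] is positive. So the
   cell lands in the simplex that supports [f s0]. *)
move=> c oc; have subc : cell_box c `<=` ssphere R I := cell_sub_sphere M0 oc.
pose s0 : {ptws I -> R} := cell_lo c.
have cs0 : cell_box c s0 by move=> i; rewrite lexx cell_lo_le_hi.
have [p0 p1] := Kf s0 (subc _ cs0).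
have shrink_c K : down_closed K -> finset (fun v => f s0 v != 0) \in K ->
    cell_box c `<=` (fun t => H (at_time 1 t)) @^-1` geometric K.
  move=> dK' sK t ct; rewrite /H /= mul1r.
  have [q0 q1 _] := Kf t (subc _ ct).
  have [s1 s2] := shrink_simplex q1 (lexx _).
  apply: (geometric_support dK' sK) => // v /shrink_supp fv; rewrite inE.
  have := fM s0 t (subc _ cs0) (subc _ ct) (cell_small M0 cs0 ct) v.
  have {}fv : shrink_max < f t v := fv.
  by rewrite ltr_norml => /andP[lo _]; rewrite gt_eqF //; lra.
by rewrite inE => /orP[sK|sK]; [left|right]; exact: shrink_c.
Qed.

Definition vertex_point (a : V) : V -> R := fun v => (v == a)%:R.

(** The straight-line homotopy to the apex stays in the cone and ends at a constant map, which
    extends. *)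
Lemma fills_spheres_cone d K (a : V) : [set a]%SET \in K ->
  (forall s, s \in K -> a |: s \in K) -> down_closed K ->
  fills_spheres (geometric K) d.
Proof.
move=> aK coneK dK I f _ [cf Kf].
pose H (t : {ptws option I -> R}) : V -> R := fun v =>
  (1 - t None) * f (spatial t) v + t None * vertex_point a v.
have sph t : @cylinder R I t -> ssphere R I (spatial t) by case.
have mH : map_on (@cylinder R I) (geometric K) H.
  split=> [v|t [ts /andP[t0 t1]]].
    apply: cont_onD; apply: cont_onM.
    - apply: cont_onD; first exact: cont_on_cst.
      by apply: cont_onN; exact: cont_on_coord.
    - exact: (cont_on_comp sph (@cont_on_spatial R I _) (cf v)).
    - exact: cont_on_coord.
    - exact: cont_on_cst.
  have [p0 p1 pK] := Kf _ ts.
  apply: (geometric_support dK (coneK _ pK)) => [v||v].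
  - by rewrite addr_ge0 // mulr_ge0 ?subr_ge0 // ler0n.
  - rewrite big_split /= -!mulr_sumr p1 mulr1 (bigD1 a) //= big1 =>
      [|u /negbTE ua].
      by rewrite /vertex_point eqxx addr0 mulr1 subrK.
    by rewrite /vertex_point ua.
  - apply: contraR; rewrite !inE negb_or negbK => /andP[va /eqP pv].
    by rewrite /H /vertex_point pv (negbTE va) !mulr0 addr0.
apply: (@extendable_eq _ _ _ _ _ _ (fun t => H (at_time 0 t))).
  move=> t ts; apply/funext => v; rewrite /H /= subr0 mul1r mul0r addr0.
  by congr (f _ _).
apply: homotopy_extendable => //.
exists (fun=> vertex_point a) => [|t ts].
  apply: map_on_cst; apply: (geometric_support dK aK) => [v||v].
  - exact: ler0n.
  - by rewrite (bigD1 a) //= big1 => [|u /negbTE ua];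
      rewrite /vertex_point ?eqxx ?addr0 ?ua.
  - by rewrite /vertex_point inE pnatr_eq0 eqb0 negbK.
by apply/funext => v; rewrite /H /= subrr mul0r add0r mul1r.
Qed.

End Complexes.

(** * Independence complexes and total domination *)

Section Domination.
Context {R : realType} {V : finType} (e : rel V).
Hypotheses (e_sym : symmetric e) (e_irr : irreflexive e).
Implicit Types (A B D T s : {set V}) (K L : {set {set V}}).

Definition independents A : {set {set V}} :=
  [set s in independence_complex e | s \subset A]%SET.

Definition nonadjacent D : {set V} := [set w | [forall u in D, ~~ e u w]]%SET.

(** The graph induced on [A] has no total dominating set of size at most [m]; for [D] empty this
    contains that [A] is nonempty. *)
Definition undominated A m : Prop :=
  forall D, D \subset A -> (#|D| <= m)%N ->
    (A :&: nonadjacent D != finset.set0)%SET.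

Lemma nonadjacentU D T :
  nonadjacent (D :|: T) = (nonadjacent D :&: nonadjacent T)%SET.
Proof.
apply/setP => w; rewrite !inE;
  apply/forall_inP/andP => [DT|[/forall_inP Dw /forall_inP Tw] u].
  by split; apply/forall_inP => u uD; apply: DT; rewrite inE uD ?orbT.
by rewrite inE => /orP[/Dw|/Tw].
Qed.

Lemma undominatedW A m m' : (m' <= m)%N -> undominated A m -> undominated A m'.
Proof. by move=> mm' Am D DA Dm; apply: Am => //; exact: leq_trans mm'. Qed.

(** A set [D] of [m] vertices dominating the non-neighbours of [T] would, together with [T],
    dominate [A]. *)
Lemma undominated_link A T m : T \subset A -> undominated A (#|T| + m) ->
  undominated (A :&: nonadjacent T) m.
Proof.
move=> TA Am D; rewrite finset.subsetI => /andP[DA _] Dm.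
rewrite -finset.setIA -nonadjacentU; apply: Am;
  first by rewrite finset.subUset TA DA.
by rewrite (leq_trans (leq_card_setU _ _)) // leq_add2l.
Qed.

Lemma independentsI A B :
  (independents A :&: independents B = independents (A :&: B))%SET.
Proof.
by apply/setP => s; rewrite !inE finset.subsetI andbACA andbb.
Qed.

Lemma down_closed_independents A : down_closed (independents A).
Proof.
move=> s t; rewrite !inE => /andP[/andP[_ /forall_inP si] sA] ts t0.
rewrite t0 (fintype.subset_trans ts sA) andbT; apply/forall_inP => u ut.
apply/forall_inP => v vt; have /forall_inP := si u (fintype.subsetP ts u ut).
by apply; exact: (fintype.subsetP ts).
Qed.

(** For [b] in [A], [independents (A :&: nonadjacent [set b])] is the closed star of [b]: by
    irreflexivity it contains [b]. The set [T] records further vertices whose stars the union has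
    been intersected with. *)
Definition star_union A T B : {set {set V}} :=
  (\bigcup_(b in B) independents (A :&: nonadjacent (b |: T)))%SET.

Lemma down_closed_star_union A T B : down_closed (star_union A T B).
Proof.
move=> s t /finset.bigcupP[b bB sb] ts t0; apply/finset.bigcupP; exists b => //.
exact: down_closed_independents sb ts t0.
Qed.

(** Independent sets avoiding the neighbours of two sets avoid those of their union, so intersecting
    with one more star just adds [b] to [T]. *)
Lemma star_unionI A T B b :
  (independents (A :&: nonadjacent (b |: T)) :&: star_union A T B =
   star_union A (b |: T) B)%SET.
Proof.
rewrite /star_union big_distrr; apply: eq_bigr => c _ /=.
rewrite independentsI !nonadjacentU; congr independents.
rewrite finset.setIACA finset.setIid; congr (_ :&: _)%SET.
by rewrite finset.setIACA finset.setIid (finset.setIC (nonadjacent [set b]))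
  finset.setIA.
Qed.

(** The star is a cone with apex [b]. *)
Lemma fills_star d A b : b \in A ->
  fills_spheres (@geometric R V (independents (A :&: nonadjacent [set b]))) d.
Proof.
move=> bA; have bN u : (u \in nonadjacent [set b]) = ~~ e b u.
  rewrite inE; apply/forall_inP/idP => [/(_ b)|ebu c]; first by rewrite inE;
    exact.
  by rewrite inE => /eqP ->.
apply: (@fills_spheres_cone _ _ _ _ b); last exact: down_closed_independents.
  rewrite !inE finset.sub1set inE bA bN e_irr andbT; apply/andP; split.
    by apply/set0Pn; exists b; rewrite inE.
  apply/forall_inP => u; rewrite inE => /eqP ->.
  by apply/forall_inP => v; rewrite inE => /eqP ->; rewrite e_irr.
move=> s; rewrite !inE => /andP[/andP[s0 si] sAb].
have sN u : u \in s -> ~~ e b u.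
  by move=> /(fintype.subsetP sAb); rewrite inE bN => /andP[].
apply/andP; split; last first.
  by rewrite finset.subUset finset.sub1set inE bA bN e_irr.
apply/andP; split; first by apply/set0Pn; exists b; rewrite !inE eqxx.
apply/forall_inP => u /setU1P us; apply/forall_inP => v /setU1P vs.
case: us vs => [->|us] [->|vs].
- by rewrite e_irr.
- exact: sN.
- by rewrite e_sym; exact: sN.
- by have /forall_inP/(_ u us)/forall_inP := si; apply.
Qed.

(** The stars are glued one at a time. The last hypothesis ranges over subsets [B'] because each
    step meets the union over the remaining vertices only. *)
Lemma fills_star_union d A T B : B != finset.set0 ->
  (forall b, b \in B ->
     fills_spheres (@geometric R V (independents (A :&: nonadjacent
       (b |: T)))) d) ->
  ((0 < d)%N -> forall b B', b \in B -> B' \subset B -> B' != finset.set0 ->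
     fills_spheres (@geometric R V (star_union A (b |: T) B')) d.-1) ->
  fills_spheres (@geometric R V (star_union A T B)) d.
Proof.
elim: {B}_.+1 {-2}B (ltnSn #|B|) => // m IH B Bm /set0Pn[b bB] fill fillI.
rewrite /star_union (bigD1 b) //=.
have -> : (\bigcup_(c in B | c != b) independents (A :&: nonadjacent
  (c |: T)))%SET =
    star_union A T (B :\ b).
  by apply: eq_bigl => c; rewrite !inE andbC.
have subB : B :\ b \subset B by exact: subD1set.
have [B0|B0] := eqVneq (B :\ b) finset.set0.
  by rewrite B0 /star_union big_set0 finset.setU0; exact: fill.
apply: fills_spheresU.
- exact: down_closed_independents.
- exact: down_closed_star_union.
- exact: fill.
- apply: IH => // [|c|d0 c B' cB' B'B].
  + by rewrite -ltnS (leq_trans _ Bm) // ltnS [X in (_ < X)%N](cardsD1 b) bB.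
  + by move=> /(fintype.subsetP subB); exact: fill.
  + by apply: fillI => //;
      [exact: (fintype.subsetP subB)|exact: fintype.subset_trans subB].
- by move=> d0; rewrite star_unionI; exact: fillI.
Qed.

(** Both claims are proved together by induction on [d]. The first glues cones along unions with
    [#|T| = 1] in dimension [d - 1], which asks for [1 + (2 * (d - 1) + 1) = 2 * d]. In the second,
    adding [b] to [T] uses up one vertex: [2 * d] remain for each piece, by the first claim, and
    more than the required [2 * d - 1] for the intersections. *)
Lemma fills_independents d :
  (forall A, undominated A (2 * d) ->
     fills_spheres (@geometric R V (independents A)) d) /\
  (forall A T B, T \subset A -> B \subset A -> B != finset.set0 ->
     undominated A (#|T| + (2 * d).+1) ->
     fills_spheres (@geometric R V (star_union A T B)) d).
Proof.
elim/ltn_ind: d => d IH.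
have IHd : (0 < d)%N -> forall A T B, T \subset A -> B \subset A ->
    B != finset.set0 -> undominated A (#|T| + (2 * d).-1) ->
    fills_spheres (@geometric R V (star_union A T B)) d.-1.
  move=> d0 A T B TA BA B0 AT; have [|_] := IH d.-1; first by rewrite prednK.
  by apply=> //; apply: undominatedW AT; lia.
have fillK A : undominated A (2 * d) ->
    fills_spheres (@geometric R V (independents A)) d.
  (* A simplex lies in the star of each of its vertices, so the stars cover the complex. *)
  move=> Ad; have -> : independents A = star_union A finset.set0 A.
    apply/setP => s; apply/idP/finset.bigcupP => [|[b bA]]; last first.
      by rewrite !inE finset.subsetI => /andP[/andP[-> ->] /andP[-> _]].
    rewrite !inE => /andP[/andP[s0 si] sA].
    have /set0Pn[b bs] := s0.
    exists b; first exact: (fintype.subsetP sA).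
    rewrite !inE s0 si finset.subsetI sA /=.
    apply/fintype.subsetP => u us; rewrite finset.setU0 inE.
    apply/forall_inP => c; rewrite inE => /eqP ->.
    by have /forall_inP/(_ b bs)/forall_inP := si; apply.
  apply: fills_star_union => [|b bA|d0 b B bA BA B0].
  - have := Ad finset.set0 (finset.sub0set _).
    by rewrite cards0 => /(_ isT) /set0Pn[w /setIP[wA _]]; apply/set0Pn;
      exists w.
  - by rewrite finset.setU0; exact: fills_star.
  - apply: IHd => //.
    + by rewrite finset.setU0 finset.sub1set.
    + by rewrite finset.setU0 cards1; apply: undominatedW Ad; lia.
split=> // A T B TA BA B0 AT.
have subA b : b \in B -> b |: T \subset A.
  by move=> bB; rewrite finset.subUset TA finset.sub1set (fintype.subsetP BA).
have cardU b : (#|b |: T| <= #|T|.+1)%N by rewrite cardsU1; case: (b \notin T).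
apply: fills_star_union => // [b bB|d0 b B' bB B'B B'0].
  apply: fillK; apply: undominated_link; first exact: subA.
  by apply: undominatedW AT; have := cardU b; lia.
apply: IHd => //; first exact: subA.
  exact: fintype.subset_trans B'B BA.
by apply: undominatedW AT; have := cardU b; lia.
Qed.

Lemma fills_independence_complex d :
  (forall D, total_dominating e D -> (2 * d < #|D|)%N) ->
  fills_spheres (@geometric R V (independence_complex e)) d.
Proof.
move=> domd; have -> : independence_complex e = independents [set: V].
  by apply/setP => s; rewrite [in RHS]inE finset.subsetT andbT.
have [fillK _] := fills_independents d; apply: fillK => D _ Dd.
have : ~~ total_dominating e D by apply: contraL Dd => /domd; rewrite -ltnNge.
rewrite negb_forall => /existsP[w]; rewrite negb_exists_in => /forall_inP wD.
apply/set0Pn; exists w; rewrite finset.setTI inE; apply/forall_inP => u uD.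
by rewrite e_sym; exact: wD.
Qed.

End Domination.

(** * Kneser graphs *)

Section Counting.

(** The neighbourhoods of the elements of [D] cover the vertex set. *)
Lemma card_le_degree_dominating (V : finType) (e : rel V) (k : nat) (D :
  {set V}) :
  (forall u, #|[set v | e v u]%SET| <= k)%N -> total_dominating e D ->
  (#|V| <= #|D| * k)%N.
Proof.
move=> degk /forallP domD.
have /fintype.subset_leq_card :
  [set: V]%SET \subset (\bigcup_(u in D) [set v | e v u]%SET)%SET.
  apply/fintype.subsetP => v _; have /exists_inP[u uD evu] := domD v.
  by apply/finset.bigcupP; exists u; rewrite ?inE.
rewrite cardsT => /leq_trans; apply.
apply: (@leq_trans (\sum_(u in D) #|[set v | e v u]%SET|)).
  elim/big_rec2: _ => [|u s A _ IH]; first by rewrite cards0.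
  by rewrite (leq_trans (leq_card_setU _ _)) // leq_add2l.
by rewrite -sum_nat_const leq_sum.
Qed.

Lemma card_kneser_vertex n k : #|kneser_vertex n k| = 'C(2 * n + k, n).
Proof.
rewrite card_sig -[in RHS](card_ord (2 * n + k)) -card_draws.
by apply: eq_card => S; rewrite !inE.
Qed.

(** The neighbours of [U] are the [n]-subsets of its complement, which has [n + k] elements. *)
Lemma kneser_degree n k (U : kneser_vertex n k) :
  #|[set S | @kneser n k S U]%SET| = 'C(n + k, n).
Proof.
have /eqP cU := valP U.
have cC : #|~: val U| = (n + k)%N.
  by apply/eqP; rewrite -(eqn_add2l #|val U|) cardsC card_ord cU; apply/eqP;
    lia.
rewrite -cC -cards_draws.
rewrite -(card_imset _ (val_inj : injective (val : kneser_vertex n k -> _))).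
apply: eq_card => S; rewrite !inE; apply/imsetP/andP => [[W]|[SU Sn]].
  rewrite inE /kneser finset.disjoints_subset => WU ->; split=> //;
    exact: (valP W).
by exists (Sub S Sn); rewrite // inE /kneser SubK finset.disjoints_subset.
Qed.

Lemma kneser_ratio_le n k (D : {set kneser_vertex n k}) :
  total_dominating (@kneser n k) D -> kneser_ratio n k <= #|D|%:R.
Proof.
move=> tD; have C0 : (0 < 'C(n + k, n))%N by rewrite bin_gt0 leq_addr.
rewrite /kneser_ratio ler_pdivrMr ?ltr0n // -natrM ler_nat.
rewrite -card_kneser_vertex; apply: card_le_degree_dominating tD => u.
by rewrite kneser_degree.
Qed.

End Counting.

(** * Homotopy groups of the realization *)

Section Realization.
Context {R : realType} {V : finType} (K : {set {set V}}).
Local Notation X := (realization R K).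

(** The point [x] is a default value for [p] outside the realization, which makes maps into [X]
    total. *)
Definition to_point (x : X) (p : V -> R) : X :=
  if pselect (geometric K p) is left pK then exist _ p (mem_set pK) else x.

Lemma val_to_point x p : geometric K p -> val (to_point x p) = p.
Proof. by rewrite /to_point; case: pselect. Qed.

Lemma geometric_val (x : X) : geometric K (val x).
Proof. exact: set_valP. Qed.

Lemma to_point_val x y : to_point x (val y) = y.
Proof. by apply: val_inj; rewrite val_to_point //; exact: geometric_val. Qed.

Lemma cont_on_val (T : topologicalType) (A : set T) (f : T -> X) v :
  {within A, continuous f} -> cont_on A (fun t => (val (f t) : V -> R) v).
Proof.
move=> cf; apply/cont_onP => t At; have /subspace_continuousP/(_ t At) ft := cf.
have : {for f t, continuous (fun x : X => (val x : V -> R) v)}.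
  apply: (@continuous_comp _ _ _ (val : X -> {ptws V -> R}) (fun p => p v)).
    exact: initial_continuous.
  exact: (@proj_continuous V (fun=> R : topologicalType) v).
by move=> cv; apply: cvg_comp ft cv.
Qed.

Lemma within_to_point (T : topologicalType) (A : set T) x (f : T -> V -> R) :
  map_on A (geometric K) f ->
    {within A, continuous (fun t => to_point x (f t))}.
Proof.
move=> [cf Kf]; apply/subspace_continuousP => t At B [C [[W oW <-] Wt CB]].
have ft : (f : T -> {ptws V -> R}) @ within A (nbhs t) --> (f t :
  {ptws V -> R}).
  by apply: cvg_ptws => v; have /cont_onP := cf v; exact.
have {}Wt : W (f t) by rewrite -(val_to_point x (Kf t At)).
have := ft W (open_nbhs_nbhs (conj oW Wt)).
rewrite /nbhs /= /within /=; apply: filterS => s fs As.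
by apply: CB; rewrite /= set_valE val_to_point; [exact: fs|exact: Kf].
Qed.

(** Any two spheroids are homotopic: one at the bottom, the other at the top and the base point on
    the sides form a map on the boundary of a cube of dimension [m + 1], and a filling is the
    homotopy. *)
Lemma fills_spheres_vanishes d m (x : X) : (m < d)%N ->
  fills_spheres (@geometric R V K) d -> homotopy_group_vanishes R m x.
Proof.
move=> md fillK.
have homot (f g : {ptws 'I_m -> R} -> X) :
    spheroid x f -> spheroid x g -> homotopic x f g.
  move=> [cf fx] [cg gx].
  pose u (h : {ptws 'I_m -> R} -> X) : {ptws option 'I_m -> R} -> V -> R :=
    fun t => val (h (spatial t)).
  (* On the rims both [f] and [g] take the value [x], so the pieces agree. *)
  pose F (t : {ptws option 'I_m -> R}) : V -> R :=
    if t None == 0 then u f t else if t None == 1 then u g t else val x.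
  pose lo : option 'I_m -> R := fun=> 0; pose hi : option 'I_m -> R := fun=> 1.
  pose side := [set t : {ptws option 'I_m -> R} |
    exists2 i : 'I_m, true &
      ([set t | t (Some i) = 0] `|` [set t | t (Some i) = 1]) t].
  pose B s := box lo hi `&` [set t : {ptws option 'I_m -> R} | t None = s].
  have sideE t : box lo hi t -> side t -> cube_boundary R m (spatial t).
    move=> tb [i _ ti]; split; first by move=> j; exact: (tb (Some j)).
    by exists i.
  have clB s : closed (B s).
    by apply: closedI; [exact: closed_box|exact: closed_coord_eq].
  have clside : closed (box lo hi `&` side).
    apply: closedI; first exact: closed_box.
    by apply: closed_exists2 => i; apply: closedU; exact: closed_coord_eq.
  have mu s h : {within cube R m, continuous h} ->
    map_on (B s) (geometric K) (u h).
    move=> ch; split=> [v|t _]; last exact: geometric_val.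
    apply: (@cont_on_comp _ _ _ (B s) (cube R m) (@spatial R 'I_m)
      (fun t => (val (h t) : V -> R) v)).
    - by move=> t [tb _] i; exact: (tb (Some i)).
    - exact: cont_on_spatial.
    - exact: cont_on_val.
  have mF0 : map_on (B 0) (geometric K) F.
    by apply: map_on_eq (mu 0 f cf) => t [_ /= t0]; rewrite /F t0 eqxx.
  have mF1 : map_on (B 1) (geometric K) F.
    by apply: map_on_eq (mu 1 g cg) => t [_ /= t1]; rewrite /F t1 eqxx oner_eq0.
  have Fside t : box lo hi t -> side t -> F t = val x.
    move=> tb /(sideE t tb) ts; rewrite /F /u fx // gx //.
    by case: ifP => // _; case: ifP.
  have mFs : map_on (box lo hi `&` side) (geometric K) F.
    apply: (@map_on_eq _ _ _ _ _ (fun=> val x)); first by move=> t [tb ts];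
      rewrite Fside.
    by apply: map_on_cst; exact: geometric_val.
  have mF := map_onU (closedU (clB 0) (clB 1)) clside
    (map_onU (clB 0) (clB 1) mF0 mF1) mFs.
  have [|||G mG GF] := @fills_spheres_box R V (geometric K) d _ lo hi F fillK.
  - by move=> i; exact: ler01.
  - by rewrite (leq_trans (max_card _)) // card_option card_ord.
  - apply: map_onW mF => // t [tb [[i|] [_ ti]]]; first by right; split=> //;
      exists i.
    by left; case: ti => ?; [left|right].
  exists (fun st => to_point x (G (at_time st.1 st.2))).
  have bd t i : box lo hi t -> t i = 0 \/ t i = 1 -> box_boundary lo hi t.
    by move=> tb ti; split=> //; exists i; split=> //; exact: ltr01.
  have tbox s t : 0 <= s <= 1 -> cube R m t -> box lo hi (at_time s t).
    by move=> s01 tc [i|] //; exact: tc.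
  split=> [|t tc|t tc|s t s01 tb].
  - apply: within_to_point; apply: (map_on_comp _ _ mG).
      by move=> [s t] [/= s01 tc]; apply: tbox => //; move: s01; rewrite in_itv.
    by apply: cont_on_at_time; apply: continuous_subspaceT => p;
      [exact: cvg_fst|exact: cvg_snd].
  - have b0 : box lo hi (at_time 0 t) by apply: tbox; rewrite ?lexx ?ler01.
    rewrite /= GF; last by apply: (bd _ None) => //; left.
    by rewrite /F /= eqxx /u to_point_val.
  - have b1 : box lo hi (at_time 1 t) by apply: tbox; rewrite ?lexx ?ler01.
    rewrite /= GF; last by apply: (bd _ None) => //; right.
    by rewrite /F /= eqxx oner_eq0 /u to_point_val.
  - have [tc [i ti]] := tb; have bs := tbox s t s01 tc.
    rewrite /= GF; last by apply: (bd _ (Some i)).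
    by rewrite Fside ?to_point_val //; exists i.
have classE (f g : {ptws 'I_m -> R} -> X) : spheroid x f -> spheroid x g ->
    homotopy_class x f = homotopy_class x g.
  by move=> sf sg; apply/seteqP; split=> h [sh _]; split=> //; exact: homot.
have scst : spheroid x (cst x : {ptws 'I_m -> R} -> X).
  by split=> // t; exact: cvg_cst.
apply/seteqP; split=> [_ [f sf <-]|_ ->]; last by exists (cst x).
exact: classE.
Qed.

(** The vanishing in degree [i] fills a cube of dimension [i + 1]. Filling in dimension 0 gives a
    point of [X], since the 0-cube has empty boundary. *)
Lemma fills_spheres_connected (j : int) :
  fills_spheres (@geometric R V K) 0 ->
  (forall i : nat, i%:Z <= j -> fills_spheres (@geometric R V K) i.+1) ->
  j_connected R j X.
Proof.
move=> fill0 fillK; split; last first.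
  by move=> i x ij; apply: (@fills_spheres_vanishes i.+1); rewrite ?ltnSn //;
    exact: fillK.
have [||g [_ Kg] _] := fill0 'I_0 (fun=> fun=> 0).
- by rewrite card_ord.
- split=> [v|t]; first exact: cont_on_cst.
  by case=> _ [[]].
pose t0 : {ptws 'I_0 -> R} := fun=> 0.
have Kt : geometric K (g t0) by apply: Kg => -[].
by exists (exist _ (g t0) (mem_set Kt)).
Qed.

End Realization.

(** * Connectivity of the independence complexes of Kneser graphs *)

Lemma kneser_connected (R : realType) (n k : nat) (j : int) : (0 < n)%N ->
  (forall i : nat, i%:Z <= j -> ((2 * i.+1)%:R < kneser_ratio n k)) ->
  j_connected R j (realization R (independence_complex (@kneser n k))).
Proof.
move=> n0 ratio; have fill d : (2 * d)%:R < kneser_ratio n k ->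
    fills_spheres (@geometric R _ (independence_complex (@kneser n k))) d.
  move=> rd; apply: fills_independence_complex => [||D /kneser_ratio_le].
  - exact: kneser_sym.
  - exact: kneser_irr.
  - by move/(lt_le_trans rd); rewrite ltr_nat.
apply: fills_spheres_connected => [|i ij]; last exact/fill/ratio.
apply: fill; rewrite divr_gt0 // ltr0n bin_gt0; lia.
Qed.

Theorem theorem6p1 (R : realType) (n k : nat) (hn : (2 <= n)%N) :
  [/\ kneser_ratio n k <= (total_domination_number (@kneser n k))%:R,
      kneser_alpha n k \is a Num.int ->
        j_connected R (Num.floor (kneser_alpha n k) - 2)
          (realization R (independence_complex (@kneser n k)))&
      kneser_alpha n k \isn't a Num.int ->
        j_connected R (Num.floor (kneser_alpha n k) - 1)
          (realization R (independence_complex (@kneser n k)))].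
Proof.
have ratioE : kneser_ratio n k = 2 * kneser_alpha n k.
  by rewrite /kneser_alpha; field.
split.
- have [[D tD <-] _] := total_domination_numberP (@kneser_no_isolated n k).
  exact: kneser_ratio_le.
- move=> /floorK fK; apply: kneser_connected => [|i ij]; first exact: ltnW.
  (* For an integer alpha, [i <= alpha - 2] yields the strict inequality [i + 1 < alpha]. *)
  rewrite ratioE -fK natrM ltr_pM2l // -[i.+1%:R]/(i.+1%:Z%:~R) ltr_int; lia.
- move=> nint; apply: kneser_connected => [|i ij]; first exact: ltnW.
  rewrite ratioE natrM ltr_pM2l //.
  (* For alpha not an integer the floor is strictly smaller, so [i + 1 <= floor alpha] suffices and
     one more degree is gained. *)
  have fl : (Num.floor (kneser_alpha n k))%:~R < kneser_alpha n k.
    rewrite lt_neqAle floor_le ?andbT ?num_real //.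
    by apply: contra nint => /eqP <-; exact: intr_int.
  apply: le_lt_trans fl; rewrite -[i.+1%:R]/(i.+1%:Z%:~R) ler_int; lia.
Qed.
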